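(* Let $W$ be either $W_{A_{n-1}}$, $W_{D_n}$ or $W_{B_n}$. The even center $\mathcal Z(\mathbb H^{cc}_W)$ contains $\mathbb C[x_1^2,\dots,x_n^2]^W$ and $\mathbb C[y_1^2,\dots,y_n^2]^W$ as subalgebras. In particular, $\mathbb H^{cc}_W$ is module-finite over its even center.
   Context: All algebras are over $\mathbb C$; $[x,y]=xy-yx$. The even center $\mathcal Z(A)$ of a superalgebra ($\mathbb Z_2$-graded algebra) $A$ is the set of even elements of $A$ that are central in $A$. Superscript $W$ denotes $W$-invariants. Weyl groups: $W_{A_{n-1}}=S_n$, $W_{B_n}$ is the group of signed permutations of $1,\dots,n$, $W_{D_n}$ the subgroup of even signed permutations. $s_{ij}$ is the transposition of $i,j$; $\overline s_{ij}$ is the transposition of $i,j$ coupled with sign changes at $i,j$; $\tau_i$ is the sign change at $i$. $W$ acts on the span of symbols $a_1,\dots,a_n$ ($a=x,y,c,e$) by signed permutation of indices, $a_i\mapsto a_i^\sigma$: $s_{ij}$ swaps $a_i,a_j$; $\overline s_{ij}$ sends $a_i\mapsto-a_j$, $a_j\mapsto-a_i$; $\tau_i$ sends $a_i\mapsto-a_i$. $\mathcal C_{2n}$ is the Clifford algebra generated by pairwise anticommuting $c_1,\dots,c_n,e_1,\dots,e_n$ of square $1$. Let $t,u,v\in\mathbb C$ ($v$ occurs only in type $B$). $\mathbb H^{cc}_W$ is the algebra generated by $x_i,y_i$ ($1\le i\le n$), $\mathcal C_{2n}$ and $W$ subject to, for all $i,j$ and $\sigma\in W$: $x_ix_j=x_jx_i$,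 $y_iy_j=y_jy_i$, $\sigma a_i=a_i^\sigma\sigma$ for $a=c,e,x,y$, $e_ix_j=x_je_i$, $c_ix_j=(-1)^{\delta_{ij}}x_jc_i$, $c_iy_j=y_jc_i$, $e_iy_j=(-1)^{\delta_{ij}}y_je_i$, and, with $i\ne j$: Type $A_{n-1}$: $[y_i,x_j]=u(1+c_ic_j)(1+e_je_i)s_{ij}$, $\ [y_i,x_i]=tc_ie_i-u\sum_{k\ne i}(1+c_kc_i)(1+e_ke_i)s_{ki}$. Types $D_n$, $B_n$: $[y_i,x_j]=u(1+c_ic_j)(1+e_je_i)s_{ij}-u(1-c_ic_j)(1-e_je_i)\overline s_{ij}$, $\ [y_i,x_i]=tc_ie_i-u\sum_{k\ne i}(1+c_kc_i)(1+e_ke_i)s_{ki}-u\sum_{k\ne i}(1-c_kc_i)(1-e_ke_i)\overline s_{ki}-v\tau_i$, where the term $-v\tau_i$ is present only in type $B_n$. It is a superalgebra with $x_i,y_i,\sigma$ even and $c_i,e_i$ odd. *)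

(* Defs.v *)
From HB Require Import structures.
From mathcomp Require Import all_boot all_order all_algebra all_fingroup.
From mathcomp Require Import generic_quotient boolp reals complex.
From mathcomp Require Import mpoly.
From mathcomp Require monalg. (* its notations clash with those of mpoly *)

Set Implicit Arguments.
Unset Strict Implicit.
Unset Printing Implicit Defensive.
Import GRing.Theory.
Local Open Scope ring_scope.
Local Open Scope quotient_scope.

Inductive ideal_gen (A : nzRingType) (rel : A -> A -> Prop) : A -> Prop :=
| ideal_rel a b l r : rel l r -> ideal_gen rel (a * (l - r) * b)
| ideal_zero : ideal_gen rel 0
| ideal_add x y : ideal_gen rel x -> ideal_gen rel y -> ideal_gen rel (x + y).

Section IdealTheory.
Variables (A : nzRingType) (rel : A -> A -> Prop).
Local Notation I := (ideal_gen rel).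

Lemma ideal_mull c x : I x -> I (c * x).
Proof.
elim=> [a b l r lr||y z _ Iy _ Iz].
- by rewrite !mulrA; apply: ideal_rel.
- by rewrite mulr0; apply: ideal_zero.
- by rewrite mulrDr; apply: ideal_add.
Qed.

Lemma ideal_mulr c x : I x -> I (x * c).
Proof.
elim=> [a b l r lr||y z _ Iy _ Iz].
- by rewrite -mulrA; apply: ideal_rel.
- by rewrite mul0r; apply: ideal_zero.
- by rewrite mulrDl; apply: ideal_add.
Qed.

Lemma ideal_opp x : I x -> I (- x).
Proof. by rewrite -mulN1r; apply: ideal_mull. Qed.

Definition ideal_eqv (x y : A) : bool := `[< I (x - y) >].

Lemma ideal_eqv_refl : reflexive ideal_eqv.
Proof. by move=> x; apply/asboolP; rewrite subrr; apply: ideal_zero. Qed.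

Lemma ideal_eqv_sym : ssrbool.symmetric ideal_eqv.
Proof.
by move=> x y; apply/asboolP/asboolP => /ideal_opp; rewrite opprB.
Qed.

Lemma ideal_eqv_trans : transitive ideal_eqv.
Proof.
move=> y x z /asboolP xy /asboolP yz; apply/asboolP.
by rewrite -(subrK y x) -addrA; apply: ideal_add.
Qed.

Canonical ideal_equiv : equiv_rel A :=
  EquivRel ideal_eqv ideal_eqv_refl ideal_eqv_sym ideal_eqv_trans.

End IdealTheory.

Definition quot_alg (A : nzRingType) (rel : A -> A -> Prop) : Type :=
  {eq_quot ideal_equiv rel}.

Definition quot_pi (A : nzRingType) (rel : A -> A -> Prop) (x : A)
  : quot_alg rel := \pi_({eq_quot ideal_equiv rel}) x.

Section QuotientRing.
Variables (A : nzRingType) (rel : A -> A -> Prop).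
Local Notation Q := (quot_alg rel).
Local Notation pi := (@quot_pi A rel).

HB.instance Definition _ := Choice.on Q.

Definition quot_repr (x : Q) : A := repr (x : {eq_quot ideal_equiv rel}).

Lemma quot_reprK x : pi (quot_repr x) = x.
Proof. exact: reprK. Qed.

Lemma quot_piP x y : pi x = pi y <-> ideal_gen rel (x - y).
Proof.
split=> [/eqmodP/asboolP //|xy]; apply/eqmodP; exact/asboolP.
Qed.

Lemma quot_repr_pi x : ideal_gen rel (x - quot_repr (pi x)).
Proof. by apply/quot_piP; rewrite quot_reprK. Qed.

Definition quot_add (x y : Q) := pi (quot_repr x + quot_repr y).
Definition quot_opp (x : Q) := pi (- quot_repr x).
Definition quot_mul (x y : Q) := pi (quot_repr x * quot_repr y).

Lemma pi_add x y : quot_add (pi x) (pi y) = pi (x + y).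
Proof.
symmetry; apply/quot_piP; rewrite opprD addrACA.
by apply: ideal_add; apply: quot_repr_pi.
Qed.

Lemma pi_opp x : quot_opp (pi x) = pi (- x).
Proof.
symmetry; apply/quot_piP; rewrite -opprD; apply: ideal_opp.
exact: quot_repr_pi.
Qed.

Lemma pi_mul x y : quot_mul (pi x) (pi y) = pi (x * y).
Proof.
symmetry; apply/quot_piP; set x' := quot_repr _; set y' := quot_repr _.
rewrite -(subrK (x * y') (x * y)) -mulrBr -addrA -mulrBl.
apply: ideal_add; first by apply: ideal_mull; apply: quot_repr_pi.
by apply: ideal_mulr; apply: quot_repr_pi.
Qed.

Lemma quot_addA : associative quot_add.
Proof.
by move=> x y z; rewrite -[x]quot_reprK -[y]quot_reprK -[z]quot_reprK
  !pi_add addrA.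
Qed.
Lemma quot_addC : commutative quot_add.
Proof.
by move=> x y; rewrite -[x]quot_reprK -[y]quot_reprK !pi_add addrC.
Qed.
Lemma quot_add0 : left_id (pi 0) quot_add.
Proof. by move=> x; rewrite -[x]quot_reprK pi_add add0r. Qed.
Lemma quot_addN : left_inverse (pi 0) quot_opp quot_add.
Proof. by move=> x; rewrite -[x]quot_reprK pi_opp pi_add addNr. Qed.

HB.instance Definition _ :=
  GRing.isZmodule.Build Q quot_addA quot_addC quot_add0 quot_addN.

Lemma quot_mulA : associative quot_mul.
Proof.
by move=> x y z; rewrite -[x]quot_reprK -[y]quot_reprK -[z]quot_reprK
  !pi_mul mulrA.
Qed.
Lemma quot_mul1l : left_id (pi 1) quot_mul.
Proof. by move=> x; rewrite -[x]quot_reprK pi_mul mul1r. Qed.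
Lemma quot_mul1r : right_id (pi 1) quot_mul.
Proof. by move=> x; rewrite -[x]quot_reprK pi_mul mulr1. Qed.
Lemma quot_mulDl : left_distributive quot_mul +%R.
Proof.
move=> x y z; rewrite -[x]quot_reprK -[y]quot_reprK -[z]quot_reprK.
by rewrite -[_ + _]/(quot_add _ _) -[RHS]/(quot_add _ _) !(pi_add, pi_mul) mulrDl.
Qed.
Lemma quot_mulDr : right_distributive quot_mul +%R.
Proof.
move=> x y z; rewrite -[x]quot_reprK -[y]quot_reprK -[z]quot_reprK.
by rewrite -[_ + _]/(quot_add _ _) -[RHS]/(quot_add _ _) !(pi_add, pi_mul) mulrDr.
Qed.

(* The quotient is not assumed to be nonzero: hence a [pzRingType]. *)
HB.instance Definition _ := GRing.Zmodule_isPzRing.Build Q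
  quot_mulA quot_mul1l quot_mul1r quot_mulDl quot_mulDr.

Lemma quot_pi_is_additive : {morph pi : x y / x - y}.
Proof. by move=> x y; rewrite -pi_add -pi_opp. Qed.
HB.instance Definition _ :=
  GRing.isZmodMorphism.Build A Q pi quot_pi_is_additive.

Lemma quot_pi_is_multiplicative : monoid_morphism pi.
Proof. by split=> // x y; rewrite -pi_mul. Qed.
HB.instance Definition _ :=
  GRing.isMonoidMorphism.Build A Q pi quot_pi_is_multiplicative.

Lemma quot_pi_rel l r : rel l r -> pi l = pi r.
Proof.
move=> lr; apply/quot_piP.
by rewrite -[_ - _]mulr1 -[_ - _]mul1r; apply: ideal_rel.
Qed.

End QuotientRing.

Section QuotientModule.
Variables (F : comNzRingType) (A : lalgType F) (rel : A -> A -> Prop).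
Local Notation Q := (quot_alg rel).
Local Notation pi := (@quot_pi A rel).

Definition quot_scale (k : F) (x : Q) : Q := pi (k *: quot_repr x).

Lemma pi_scale k x : quot_scale k (pi x) = pi (k *: x).
Proof.
symmetry; apply/quot_piP; rewrite -scalerBr -mulr_algl; apply: ideal_mull.
exact: quot_repr_pi.
Qed.

Lemma quot_scaleA a b x : quot_scale a (quot_scale b x) = quot_scale (a * b) x.
Proof. by rewrite -[x]quot_reprK !pi_scale scalerA. Qed.
Lemma quot_scale1 : left_id 1 quot_scale.
Proof. by move=> x; rewrite -[x]quot_reprK pi_scale scale1r. Qed.
Lemma quot_scaleDr : right_distributive quot_scale +%R.
Proof.
move=> a x y; rewrite -[x]quot_reprK -[y]quot_reprK -rmorphD !pi_scale.
by rewrite scalerDr rmorphD.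
Qed.
Lemma quot_scaleDl x : {morph quot_scale^~ x : a b / a + b}.
Proof. by move=> a b; rewrite -[x]quot_reprK !pi_scale scalerDl rmorphD. Qed.

HB.instance Definition _ := GRing.Zmodule_isLmodule.Build F Q
  quot_scaleA quot_scale1 quot_scaleDr quot_scaleDl.

Lemma quot_piZ k x : pi (k *: x) = k *: pi x.
Proof. by rewrite -pi_scale. Qed.

Lemma quot_scalerAl k (x y : Q) : k *: (x * y) = (k *: x) * y.
Proof.
rewrite -[x]quot_reprK -[y]quot_reprK -rmorphM -!quot_piZ -rmorphM.
by rewrite scalerAl.
Qed.

End QuotientModule.

Section SignedPerm.
Variable n : nat.

(* [(i, false)] stands for the letter [i] and [(i, true)] for [-i]. *)
Definition sletter := ('I_n * bool)%type.
Definition sneg (p : sletter) : sletter := (p.1, ~~ p.2).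

Definition WB_set : {set {perm sletter}} :=
  [set s : {perm sletter} | [forall p, s (sneg p) == sneg (s p)]].
Definition WD_set : {set {perm sletter}} :=
  [set s : {perm sletter} in WB_set | ~~ odd #|[set i | (s (i, false)).2]|].
Definition WA_set : {set {perm sletter}} :=
  [set s : {perm sletter} in WB_set | [forall i, ~~ (s (i, false)).2]].

Lemma WBP (s : {perm sletter}) : reflect (forall p, s (sneg p) = sneg (s p)) (s \in WB_set).
Proof. by rewrite inE; apply: (iffP forallP) => H p; apply/eqP. Qed.

Lemma WB_sign (s : {perm sletter}) i b : s \in WB_set -> s (i, b) =
  ((s (i, false)).1, b (+) (s (i, false)).2).
Proof.
move/WBP=> sB; case: b => /=; last by case: (s _).
by rewrite -[(i, true)]/(sneg (i, false)) sB.
Qed.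

Lemma WB_group_set : group_set WB_set.
Proof.
apply/group_setP; split=> [|s t /WBP sB /WBP tB]; apply/WBP => p.
  by rewrite !perm1.
by rewrite !permM sB tB.
Qed.
Canonical WB : {group {perm sletter}} := Group WB_group_set.

Lemma WA_group_set : group_set WA_set.
Proof.
apply/group_setP; split=> [|s t].
  by rewrite inE (group1 WB); apply/forallP => i; rewrite perm1.
rewrite !inE => /andP[sB /forallP sA] /andP[tB /forallP tA].
have sB' : s \in WB_set by rewrite inE.
have tB' : t \in WB_set by rewrite inE.
have := groupM (G := WB) sB' tB'; rewrite inE => -> /=.
apply/forallP => i; rewrite permM (surjective_pairing (s _)) WB_sign //=.
by rewrite (negbTE (sA i)) addFb tA.
Qed.
Canonical WA : {group {perm sletter}} := Group WA_group_set.

Lemma odd_signs (s : {perm sletter}) :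
  odd #|[set i | (s (i, false)).2]| = \big[addb/false]_i (s (i, false)).2.
Proof.
rewrite -sum1_card big_mkcond /= (big_morph odd oddD (erefl _)).
by apply: eq_bigr => i _; rewrite inE; case: (_.2).
Qed.

Lemma WD_group_set : group_set WD_set.
Proof.
apply/group_setP; split=> [|s t].
  rewrite inE (group1 WB) odd_signs big1 // => i _.
  by rewrite perm1.
rewrite !inE => /andP[sB sD] /andP[tB tD].
have sB' : s \in WB_set by rewrite inE.
have tB' : t \in WB_set by rewrite inE.
have := groupM (G := WB) sB' tB'; rewrite inE => -> /=.
have inj : injective (fun i => (s (i, false)).1).
  move=> i j ij; have Hi := WB_sign i (s (i, false)).2 sB'.
  have Hj := WB_sign j (s (j, false)).2 sB'; rewrite addbb ij in Hi.
  by rewrite addbb -Hi in Hj; case: (perm_inj Hj).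
move: sD tD; rewrite !odd_signs => sD.
rewrite [X in ~~ X -> _](reindex_inj inj) /= => tD.
under eq_bigr => i _.
  rewrite permM (surjective_pairing (s _)) WB_sign //=; over.
by rewrite big_split /= (negbTE tD) (negbTE sD).
Qed.
Canonical WD : {group {perm sletter}} := Group WD_group_set.

Definition sperm_fun (p : {perm 'I_n}) (f : pred 'I_n) (x : sletter) : sletter :=
  (p x.1, x.2 (+) f x.1).
Lemma sperm_inj p f : injective (sperm_fun p f).
Proof.
by move=> [i a] [j b] [/perm_inj ->] /addIb ->.
Qed.
Definition sperm p f : {perm sletter} := perm (@sperm_inj p f).

Definition s_ (i j : 'I_n) : {perm sletter} := sperm (tperm i j) pred0.
Definition sbar_ (i j : 'I_n) : {perm sletter} := sperm (tperm i j) (pred2 i j).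
Definition tau_ (i : 'I_n) : {perm sletter} := sperm 1%g (pred1 i).

(* [sact s a i] is a_i^s in the span of the symbols a_1, ..., a_n. *)
Definition sact (V : zmodType) (s : {perm sletter}) (a : 'I_n -> V) (i : 'I_n)
  : V :=
  let p := s (i, false) in if p.2 then - a p.1 else a p.1.

End SignedPerm.

Variant weyl_type := TypeA | TypeD | TypeB.

Definition weyl (T : weyl_type) (n : nat) : {group {perm sletter n}} :=
  match T with TypeA => WA n | TypeD => WD n | TypeB => WB n end.

Section SignedPermCheck.
Variable n : nat.

Lemma sperm_WB p f : sperm p f \in WB n.
Proof. by apply/WBP => -[i b]; rewrite !permE /sperm_fun /sneg /= addNb. Qed.

Lemma s_weyl T (i j : 'I_n) : s_ i j \in weyl T n.
Proof.
have sB := sperm_WB (tperm i j) pred0.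
case: T => //; rewrite inE sB /=.
  by apply/forallP => k; rewrite permE.
by rewrite odd_signs big1 // => k _; rewrite permE.
Qed.

Lemma sbar_weyl T (i j : 'I_n) : T <> TypeA -> i != j -> sbar_ i j \in weyl T n.
Proof.
have sB := sperm_WB (tperm i j) (pred2 i j).
case: T => // _ ij; rewrite inE sB /=.
suff -> : [set k | (sbar_ i j (k, false)).2] = [set i; j] by rewrite cards2 ij.
by apply/setP => k; rewrite !inE permE.
Qed.

Lemma tau_weyl (i : 'I_n) : tau_ i \in weyl TypeB n.
Proof. exact: sperm_WB. Qed.

End SignedPermCheck.

Inductive gen (T : weyl_type) (n : nat) :=
| GX of 'I_n | GY of 'I_n | GC of 'I_n | GE of 'I_n | GW of subg_of (weyl T n).

Section GenChoice.
Variables (T : weyl_type) (n : nat).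
Definition gen_enc (g : gen T n) :
    'I_n + ('I_n + ('I_n + ('I_n + subg_of (weyl T n)))) :=
  match g with
  | GX i => inl i | GY i => inr (inl i) | GC i => inr (inr (inl i))
  | GE i => inr (inr (inr (inl i))) | GW s => inr (inr (inr (inr s)))
  end.
Definition gen_dec (x : 'I_n + ('I_n + ('I_n + ('I_n + subg_of (weyl T n))))) :=
  match x with
  | inl i => GX T i | inr (inl i) => GY T i | inr (inr (inl i)) => GC T i
  | inr (inr (inr (inl i))) => GE T i | inr (inr (inr (inr s))) => GW s
  end.
Lemma gen_encK : cancel gen_enc gen_dec. Proof. by case. Qed.
HB.instance Definition _ := Finite.copy (gen T n) (can_type gen_encK).
End GenChoice.

Section Hcc.
Import monalg.
Variables (F : comNzRingType) (T : weyl_type) (n : nat) (t u v : F).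
Local Notation W := (weyl T n).

Definition free_alg : Type := {malg F[{fmonom gen T n}]}.
HB.instance Definition _ := GRing.Lalgebra.on free_alg.

Definition fgen (g : gen T n) : free_alg := mkmalgU (fmu g) 1.

Definition fx (i : 'I_n) : free_alg := fgen (GX T i).
Definition fy (i : 'I_n) : free_alg := fgen (GY T i).
Definition fc (i : 'I_n) : free_alg := fgen (GC T i).
Definition fe (i : 'I_n) : free_alg := fgen (GE T i).
Definition fw (s : subg_of W) : free_alg := fgen (GW s).
(* [subg W s] is [s] as an element of [W] when [s \in W], and 1 otherwise; see
   [s_weyl], [sbar_weyl] and [tau_weyl]. *)
Definition fwW (s : {perm sletter n}) : free_alg := fw (subg W s).

Local Notation x := fx.
Local Notation y := fy.
Local Notation c := fc.
Local Notation e := fe.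
Local Notation w := fw.
Local Notation wW := fwW.

Definition comm_yx (i j : 'I_n) : free_alg :=
  let plus := (1 + c i * c j) * (1 + e j * e i) * wW (s_ i j) in
  let minus := (1 - c i * c j) * (1 - e j * e i) * wW (sbar_ i j) in
  match T with
  | TypeA => u *: plus
  | TypeD | TypeB => u *: plus - u *: minus
  end.

Definition comm_yx_diag (i : 'I_n) : free_alg :=
  let plus :=
    \sum_(k < n | k != i) (1 + c k * c i) * (1 + e k * e i) * wW (s_ k i) in
  let minus :=
    \sum_(k < n | k != i) (1 - c k * c i) * (1 - e k * e i) * wW (sbar_ k i) in
  match T with
  | TypeA => t *: (c i * e i) - u *: plus
  | TypeD => t *: (c i * e i) - u *: plus - u *: minus
  | TypeB => t *: (c i * e i) - u *: plus - u *: minus - v *: wW (tau_ i)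
  end.

Inductive Hcc_rel : free_alg -> free_alg -> Prop :=
(* [(s2 * s1)%g] applies s2 first; in the presentation W acts on the left. *)
| rel_w1 : Hcc_rel (w 1%g) 1
| rel_wM s1 s2 : Hcc_rel (w s1 * w s2) (w (s2 * s1)%g)
| rel_c2 i : Hcc_rel (c i * c i) 1
| rel_e2 i : Hcc_rel (e i * e i) 1
| rel_cc i j : i != j -> Hcc_rel (c i * c j) (- (c j * c i))
| rel_ee i j : i != j -> Hcc_rel (e i * e j) (- (e j * e i))
| rel_ce i j : Hcc_rel (c i * e j) (- (e j * c i))
| rel_xx i j : Hcc_rel (x i * x j) (x j * x i)
| rel_yy i j : Hcc_rel (y i * y j) (y j * y i)
| rel_wx s i : Hcc_rel (w s * x i) (sact (sgval s) x i * w s)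
| rel_wy s i : Hcc_rel (w s * y i) (sact (sgval s) y i * w s)
| rel_wc s i : Hcc_rel (w s * c i) (sact (sgval s) c i * w s)
| rel_we s i : Hcc_rel (w s * e i) (sact (sgval s) e i * w s)
| rel_ex i j : Hcc_rel (e i * x j) (x j * e i)
| rel_cx i j : Hcc_rel (c i * x j) ((-1) ^+ (i == j) * (x j * c i))
| rel_cy i j : Hcc_rel (c i * y j) (y j * c i)
| rel_ey i j : Hcc_rel (e i * y j) ((-1) ^+ (i == j) * (y j * e i))
| rel_yx i j : i != j -> Hcc_rel (y i * x j - x j * y i) (comm_yx i j)
| rel_yx_diag i : Hcc_rel (y i * x i - x i * y i) (comm_yx_diag i).

Definition Hcc : Type := quot_alg Hcc_rel.
HB.instance Definition _ := GRing.PzRing.on Hcc.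
HB.instance Definition _ := GRing.Lmodule.on Hcc.

Definition Hpi : free_alg -> Hcc := @quot_pi _ Hcc_rel.
Definition Hx (i : 'I_n) : Hcc := Hpi (x i).
Definition Hy (i : 'I_n) : Hcc := Hpi (y i).

Lemma free_scalerAr k (a b : free_alg) : k *: (a * b) = a * (k *: b).
Proof.
have kC (g : free_alg) : k *: g = g * (@mkmalgU {fmonom gen T n} F mone k : free_alg).
  rewrite -mul_malgC; apply: etrans (fgmulUg _ _ _) _.
  apply/esym/(etrans (fgmulgU _ _ _))/eq_bigr => m _.
  by rewrite mulrC mulm1 mul1m.
by rewrite !kC mulrA.
Qed.

Lemma Hcc_scalerAl k (a b : Hcc) : k *: (a * b) = (k *: a) * b.
Proof. exact: quot_scalerAl. Qed.

Lemma Hcc_scalerAr k (a b : Hcc) : k *: (a * b) = a * (k *: b).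
Proof.
rewrite -[a](@quot_reprK _ Hcc_rel) -[b](@quot_reprK _ Hcc_rel).
by rewrite -rmorphM -!quot_piZ -rmorphM -free_scalerAr.
Qed.

Definition gen_odd (g : gen T n) : bool :=
  match g with GC _ | GE _ => true | _ => false end.
Definition word_odd (m : {fmonom gen T n}) : bool :=
  odd (count gen_odd (fmonom_val m)).

Definition Hcc_even (h : Hcc) : Prop :=
  exists2 f : free_alg,
    (forall m, word_odd m -> mcoeff m f = 0) & h = Hpi f.

Definition even_center (h : Hcc) : Prop :=
  Hcc_even h /\ forall g : Hcc, h * g = g * h.

End Hcc.

Section Invariants.
Variables (F : comNzRingType) (n : nat).

Definition weyl_act (s : {perm sletter n}) (p : {mpoly F[n]}) : {mpoly F[n]} :=
  p \mPo [tuple sact s (fun k => 'X_k) i | i < n].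

(* F[X_1^2, ..., X_n^2]^W inside F[X_1, ..., X_n] *)
Definition sq_invariant (T : weyl_type) (p : {mpoly F[n]}) : Prop :=
  (exists q : {mpoly F[n]}, p = q \mPo [tuple 'X_i ^+ 2 | i < n]) /\
  (forall s, s \in weyl T n -> weyl_act s p = p).

End Invariants.

Section Claims.
Variables (F : comNzRingType) (T : weyl_type) (n : nat) (t u v : F).
Local Notation H := (Hcc T n t u v).

(* The value p(a_1, ..., a_n); meant for pairwise commuting a_i. *)
Definition Heval (a : 'I_n -> H) (p : {mpoly F[n]}) : H :=
  \sum_(m <- mpoly.msupp p) p@_m *: \prod_(i < n) a i ^+ m i.

(* Evaluation at a_1, ..., a_n is an injective morphism of unital algebras
   from F[X_1^2, ..., X_n^2]^W into the even center of H. *)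
Definition sq_invariants_in_even_center (a : 'I_n -> H) : Prop :=
  [/\ Heval a 1 = 1,
      forall k p q, sq_invariant T p -> sq_invariant T q ->
        Heval a (k *: p + q) = k *: Heval a p + Heval a q,
      forall p q, sq_invariant T p -> sq_invariant T q ->
        Heval a (p * q) = Heval a p * Heval a q,
      forall p q, sq_invariant T p -> sq_invariant T q ->
        Heval a p = Heval a q -> p = q &
      forall p, sq_invariant T p -> even_center (Heval a p)].

Definition module_finite_over (Z : H -> Prop) : Prop :=
  exists b : seq H, forall h : H, exists z : 'I_(size b) -> H,
    (forall k, Z (z k)) /\ h = \sum_(k < size b) z k * b`_k.

End Claims.

(* Main.v *)
From HB Require Import structures.
Require Import Defs.
From mathcomp Require Import all_boot all_order all_algebra all_fingroup reals complex.
From mathcomp Require Import boolp mpoly.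
From mathcomp Require finmap monalg.

Set Implicit Arguments.
Unset Strict Implicit.
Unset Printing Implicit Defensive.
Import GRing.Theory.
Local Open Scope ring_scope.

(** The commutators [y_i, x_j] of the algebra H are sums of terms which, as far
    as the x_k are concerned, act like reflections: c_i changes the sign of x_i,
    so that s_ij, c_i c_j s_ij and their barred versions move the x_k like the
    reflections in x_i - x_j and x_i + x_j, and c_i e_i and tau_i like the
    reflection in x_i.  Everything below exploits this.

    Centrality.  The squares x_k^2 commute with all c_k and e_k and are permuted
    by W.  Adding up the terms of y_i x_j + x_j y_i one finds elements A_j,
    for j <> i, with

      [y_i, x_j^2] = A_j  and  [y_i, x_i^2] = - sum of the A_j,

    and A_j moves past polynomials in the x_k^2 by exchanging x_i^2 and x_j^2
    (sq_bracket_offdiag, sq_bracket_diag, square_crossX).  A Leibniz argument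
    gives [y_i, q(x^2)] = - sum of (D_j q)(x^2) A_j, where D_j is the divided
    difference of the transposition (i j) (bracket_eval).  For symmetric q all
    D_j q vanish, and invariance of q(x^2) under W is symmetry of q.

    Injectivity.  The elements q(x) could collapse in H only if its presentation
    collapsed, so a module is needed on which the x_i act freely.  It is the
    module of polynomials in x with values in a space V, where V carries the
    Clifford algebra and W and is killed by the y_i: the y_i act by Dunkl
    operators (dunklX).  The relations that involve only the y_i need no
    computation with divided differences: the two sides of y_i y_j = y_j y_i,
    of w y_i = +- y_k w and of the sign rules for c_k and e_k agree on V and have
    the same commutators with every x_k, and V and the x_k span the module
    (standard_rep).  For V one may take functions on the group W_B with
    values in the Jordan-Wigner module of the Clifford algebra; inducing to W_B
    makes the action of W a mere shift.

    The roles of x and y may be exchanged, together with those of c and e, at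
    the price of changing the signs of u and v (hcc_rep_swap).  All statements
    about y follow in this way from those about x.

    Finiteness.  Every x_i is a root of the polynomial with roots the squares
    x_j^2, whose coefficients are invariants; so polynomials in x are spanned over
    the invariants by finitely many monomials (mpoly_zspan), and likewise for y.
    On the other hand H is spanned by ordered products p(x) q(y) c^f e^g w
    (pbw_span_y being the only case with content), and there are finitely many
    c^f, e^g and w. *)

(** * Signed permutations *)

Section Reflections.
Variable n : nat.
Implicit Types (s : {perm sletter n}) (i j k : 'I_n) (b : bool).

Definition spos s i : 'I_n := (s (i, false)).1.
Definition ssgn s i : bool := (s (i, false)).2.

Lemma s_letter s i : s (i, false) = (spos s i, ssgn s i).
Proof. exact: surjective_pairing. Qed.

Lemma s_letterT s i b : s \in WB n -> s (i, b) = (spos s i, b (+) ssgn s i).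
Proof. exact: WB_sign. Qed.

Lemma sactE (F : pzRingType) (V : lmodType F) s (a : 'I_n -> V) i :
  sact s a i = (-1) ^+ ssgn s i *: a (spos s i) :> V.
Proof.
by rewrite /sact -/(ssgn s i) -/(spos s i); case: ssgn; rewrite ?scaleN1r ?scale1r.
Qed.

Lemma spos_inj s : s \in WB n -> injective (spos s).
Proof.
move=> sB i j ij; suff: (i, ssgn s i) = (j, ssgn s j) by case.
by apply: (@perm_inj _ s); rewrite !s_letterT // ij !addbb.
Qed.

Lemma sposM s s' i : s' \in WB n -> spos (s * s')%g i = spos s' (spos s i).
Proof. by move=> sB; rewrite /spos permM s_letter s_letterT. Qed.

Lemma ssgnM s s' i :
  s' \in WB n -> ssgn (s * s')%g i = ssgn s i (+) ssgn s' (spos s i).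
Proof. by move=> sB; rewrite /ssgn permM s_letter s_letterT. Qed.

Lemma WB_eqP s s' : s \in WB n -> s' \in WB n ->
  spos s =1 spos s' -> ssgn s =1 ssgn s' -> s = s'.
Proof.
move=> sB sB' e1 e2; apply/permP => -[i b].
by rewrite !s_letterT // e1 e2.
Qed.

Lemma spos1 i : spos 1%g i = i. Proof. by rewrite /spos perm1. Qed.
Lemma ssgn1 i : ssgn 1%g i = false. Proof. by rewrite /ssgn perm1. Qed.

(** Both reflections attached to a pair of indices are treated at once, the
    boolean recording the sign: almost every formula below is the same for s_ij
    and its barred version, up to the sign (-1) ^+ b. *)
Definition refl b i j : {perm sletter n} := if b then sbar_ i j else s_ i j.

Lemma refl_WB b i j : refl b i j \in WB n.
Proof. by case: b; apply: sperm_WB. Qed.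

Lemma tau_WB i : tau_ i \in WB n.
Proof. exact: sperm_WB. Qed.

Lemma spos_refl b i j k : spos (refl b i j) k = tperm i j k.
Proof. by rewrite /spos; case: b; rewrite permE. Qed.

Lemma ssgn_refl b i j k : ssgn (refl b i j) k = b && ((k == i) || (k == j)).
Proof. by rewrite /ssgn; case: b; rewrite permE. Qed.

Lemma spos_tau i k : spos (tau_ i) k = k.
Proof. by rewrite /spos permE /= perm1. Qed.

Lemma ssgn_tau i k : ssgn (tau_ i) k = (k == i).
Proof. by rewrite /ssgn permE. Qed.

Lemma reflC b i j : refl b i j = refl b j i.
Proof.
apply: WB_eqP => [||k|k]; rewrite ?refl_WB // ?spos_refl ?ssgn_refl 1?tpermC //.
by rewrite orbC.
Qed.

(** Conjugation by s turns the root of a reflection into its image, so s_ij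
    becomes a barred reflection exactly when s changes the sign of one of the two
    indices only. *)
Lemma refl_mull b i j s : s \in WB n ->
  (refl b i j * s)%g =
  (s * refl (b (+) ssgn s i (+) ssgn s j) (spos s i) (spos s j))%g.
Proof.
move=> sB; apply: WB_eqP => [||k|k]; rewrite ?groupM ?refl_WB //.
  rewrite !sposM ?refl_WB // !spos_refl.
  by rewrite -[RHS](inj_tperm _ _ _ (spos_inj sB)).
rewrite !ssgnM ?refl_WB // spos_refl !ssgn_refl !(inj_eq (spos_inj sB)).
case: tpermP => [->|->|/eqP/negPf-> /eqP/negPf->]; rewrite ?eqxx ?orbT ?andbT ?andbF ?addbF //.
  by case: b (ssgn s i) (ssgn s j) => [] [] [].
by case: b (ssgn s i) (ssgn s j) => [] [] [].
Qed.

Lemma tau_mull i s : s \in WB n -> (tau_ i * s)%g = (s * tau_ (spos s i))%g.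
Proof.
move=> sB; apply: WB_eqP => [||k|k]; rewrite ?groupM ?tau_WB //.
  by rewrite !sposM ?tau_WB // !spos_tau.
by rewrite !ssgnM ?tau_WB // !spos_tau !ssgn_tau (inj_eq (spos_inj sB)) addbC.
Qed.

Lemma tau_tau_refl b i j : i != j ->
  (refl b i j * tau_ j * tau_ i)%g = refl (~~ b) i j.
Proof.
move=> ij; apply: WB_eqP => [||k|k]; rewrite ?groupM ?tau_WB ?refl_WB //.
  by rewrite !sposM ?tau_WB // !spos_tau !spos_refl.
rewrite !ssgnM ?tau_WB // !sposM ?tau_WB // !spos_tau spos_refl !ssgn_refl !ssgn_tau.
case: tpermP => [->|->|/eqP/negPf ki /eqP/negPf kj]; last by rewrite ki kj !andbF.
  by rewrite !eqxx (eq_sym j i) (negPf ij) andbT andbT addbF; case: b.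
by rewrite !eqxx (negPf ij) orbT !andbT addbF; case: b.
Qed.

End Reflections.

(** * Divided differences *)

Section Polynomials.
Variables (F : fieldType) (n : nat).
Local Notation mp := {mpoly F[n]}.
Implicit Types (s : {perm sletter n}) (i j k : 'I_n) (b : bool) (p f g : mp).

(** Polynomials built one variable at a time, rather than by monomials: this is
    the form of induction adapted to Leibniz rules. *)
Lemma mpoly_XU_ind (Q : mp -> Prop) :
  (forall c, Q c%:MP) -> (forall f g, Q f -> Q g -> Q (f + g)) ->
  (forall i f, Q f -> Q ('X_i * f)) -> forall f, Q f.
Proof.
move=> QC QD QX; have Qmon m f : Q f -> Q ('X_[m] * f).
  rewrite mpolyXE_id; elim/big_rec: _ f => [|i g _ IH] f Qf; first by rewrite mul1r.
  rewrite -mulrA; move: (IH _ Qf); move: (g * f) => h; elim: (m i) => [|k IHk] Qh.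
    by rewrite expr0 mul1r.
  by rewrite exprS -mulrA; apply/QX/IHk.
elim/mpolyind => [|c m p _ _ Qp]; first by rewrite -mpolyC0; apply: QC.
by apply: QD => //; rewrite -mul_mpolyC mulrC; apply/Qmon/QC.
Qed.

Fact weyl_act_is_linear s : linear (@weyl_act F n s).
Proof. by move=> c f g; rewrite /weyl_act linearP. Qed.
HB.instance Definition _ s :=
  GRing.isLinear.Build F mp mp *:%R (@weyl_act F n s) (weyl_act_is_linear s).

Fact weyl_act_is_monoid_morphism s : monoid_morphism (@weyl_act F n s).
Proof. by split=> [|f g]; rewrite /weyl_act ?rmorph1 ?rmorphM. Qed.
HB.instance Definition _ s :=
  GRing.isMonoidMorphism.Build mp mp (@weyl_act F n s)
    (weyl_act_is_monoid_morphism s).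

Lemma weyl_actC s c : weyl_act s c%:MP = c%:MP :> mp.
Proof. exact: comp_mpolyC. Qed.

Lemma weyl_actX s i : weyl_act s 'X_i = (-1) ^+ ssgn s i *: 'X_(spos s i) :> mp.
Proof.
rewrite /weyl_act comp_mpolyXU -tnth_nth tnth_mktuple.
exact: (sactE s (fun k => 'X_k : mp)).
Qed.

Lemma weyl_actM s s' f : s' \in WB n ->
  weyl_act s' (weyl_act s f) = weyl_act (s * s')%g f.
Proof.
move=> sB; elim/mpoly_XU_ind: f => [c|f g IHf IHg|i f IH].
- by rewrite !weyl_actC.
- by rewrite !raddfD /= IHf IHg.
- rewrite !rmorphM /= IH !weyl_actX linearZ /= weyl_actX scalerA -signr_addb.
  by rewrite sposM // ssgnM.
Qed.

Lemma weyl_act1 f : weyl_act 1%g f = f.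
Proof.
elim/mpoly_XU_ind: f => [c|f g IHf IHg|i f IH].
- by rewrite weyl_actC.
- by rewrite raddfD /= IHf IHg.
- by rewrite rmorphM /= IH weyl_actX spos1 ssgn1 scale1r.
Qed.

Definition ddiff_spec (a : mp) s f g := a * g = f - weyl_act s f.

(** If a divides x_i - s(x_i) for all i, then it divides f - s(f) for all f: the
    set of such f is closed under products since
    x f - s(x) s(f) = (x - s(x)) f + s(x) (f - s(f)). *)
Lemma ddiff_exists a s : (forall i, exists g, ddiff_spec a s 'X_i g) ->
  forall f, exists g, ddiff_spec a s f g.
Proof.
rewrite /ddiff_spec => aX; elim/mpoly_XU_ind => [c|f g [f' Hf] [g' Hg]|i f [f' Hf]].
- by exists 0; rewrite mulr0 weyl_actC subrr.
- by exists (f' + g'); rewrite mulrDr Hf Hg raddfD /= opprD addrACA.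
- have [x' Hx] := aX i; exists (x' * f + weyl_act s 'X_i * f').
  rewrite mulrDr mulrA Hx mulrCA Hf rmorphM /= mulrBl mulrBr.
  by rewrite addrA subrK.
Qed.

Definition ddiff (a : mp) s f : mp :=
  if pselect (exists g, ddiff_spec a s f g) is left e then projT1 (cid e) else 0.

Section DividedDifference.
Variables (a : mp) (s : {perm sletter n}).
Hypothesis a_neq0 : a != 0.
Variable d : 'I_n -> F.
Hypothesis dX : forall i, ddiff_spec a s 'X_i (d i)%:MP.

Lemma ddiffP f : a * ddiff a s f = f - weyl_act s f.
Proof.
rewrite /ddiff; case: pselect => [e|[]]; first by case: (cid e).
by apply: ddiff_exists => i; exists (d i)%:MP; apply: dX.
Qed.

Lemma ddiff_eq f g : a * g = f - weyl_act s f -> ddiff a s f = g.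
Proof. by rewrite -ddiffP => /(mulfI a_neq0). Qed.

Lemma ddiffD f g : ddiff a s (f + g) = ddiff a s f + ddiff a s g.
Proof.
by apply: ddiff_eq; rewrite mulrDr !ddiffP raddfD /= opprD addrACA.
Qed.

Lemma ddiffZ c f : ddiff a s (c *: f) = c *: ddiff a s f.
Proof. by apply: ddiff_eq; rewrite -scalerAr ddiffP linearZ /= scalerBr. Qed.

Lemma ddiff_linear : linear (ddiff a s).
Proof. by move=> c f g; rewrite ddiffD ddiffZ. Qed.

Lemma ddiffC c : ddiff a s c%:MP = 0.
Proof. by apply: ddiff_eq; rewrite mulr0 weyl_actC subrr. Qed.

(** The twisted Leibniz rule, which is all that is used about ddiff besides
    linearity and its vanishing on constants. *)
Lemma ddiffXM i f :
  ddiff a s ('X_i * f) = 'X_i * ddiff a s f + d i *: weyl_act s f.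
Proof.
apply: ddiff_eq; rewrite mulrDr mulrCA ddiffP -mul_mpolyC mulrA dX.
by rewrite rmorphM /= mulrBr mulrBl addrA subrK.
Qed.

End DividedDifference.

Definition rroot b i j : mp := 'X_i - (-1) ^+ b *: 'X_j.
(** The divided difference of x_k along rroot b i j; it is a constant, since roots
    are linear forms. *)
Definition rcoef b i j k : F := (k == i)%:R - (-1) ^+ b * (k == j)%:R.

Lemma rroot_neq0 b i j : i != j -> rroot b i j != 0.
Proof.
move=> ij; apply/eqP => /(congr1 (mcoeff U_(i)%MM)).
rewrite mcoeff0 mcoeffB mcoeffZ !mcoeffXU eqxx eq_sym (negPf ij) mulr0 subr0.
by move/eqP; rewrite oner_eq0.
Qed.

Lemma rrootP b i j k : i != j ->
  ddiff_spec (rroot b i j) (refl b i j) 'X_k (rcoef b i j k)%:MP.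
Proof.
move=> ij; rewrite /ddiff_spec weyl_actX spos_refl ssgn_refl mulrC mul_mpolyC.
rewrite /rroot /rcoef; case: tpermP => [->|->|/eqP/negPf-> /eqP/negPf->].
- by rewrite eqxx (negPf ij) mulr0 subr0 scale1r andbT.
- rewrite eqxx eq_sym (negPf ij) orbT andbT sub0r mulr1 scaleNr scalerBr.
  by rewrite scalerA -expr2 sqrr_sign scale1r opprB.
- by rewrite andbF scale1r subrr mulr0 subrr scale0r.
Qed.

Hypothesis F2 : 2%:R != 0 :> F.

(** The factor 2 normalises the divided difference of x_i to be 1. *)
Definition troot i : mp := 2%:R *: 'X_i.

Lemma troot_neq0 i : troot i != 0.
Proof.
apply/eqP => /(congr1 (mcoeff U_(i)%MM)).
rewrite mcoeff0 mcoeffZ mcoeffXU eqxx mulr1.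
exact/eqP.
Qed.

Lemma trootP i k : ddiff_spec (troot i) (tau_ i) 'X_k (k == i)%:R%:MP.
Proof.
rewrite /ddiff_spec weyl_actX spos_tau ssgn_tau mulrC mul_mpolyC /troot scalerA.
have [->|_] := eqVneq k i; last by rewrite mul0r scale0r scale1r subrr.
by rewrite mul1r expr1 scaleN1r opprK scaler_nat mulr2n.
Qed.

End Polynomials.

(** * Operators satisfying the defining relations *)

Section OnePlus.
Variables (F : pzRingType) (M : lmodType F).

(** The factors (1 +- c_i c_j) and (1 +- e_j e_i) of the commutators. *)
Definition one_plus (a : F) (f g : M -> M) (m : M) : M := m + a *: f (g m).
End OnePlus.

Section OnePlusTheory.
Variables (F : comPzRingType) (M : lmodType F).
Implicit Types (a c : F) (f g h : {linear M -> M}).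

Fact one_plus_is_linear a f g : linear (one_plus a f g).
Proof.
by move=> c m m'; rewrite /one_plus !linearP /= scalerDr addrACA.
Qed.
HB.instance Definition _ a f g :=
  GRing.isLinear.Build F M M *:%R (one_plus a f g) (one_plus_is_linear a f g).

Lemma one_plus_twist a c f g f' g' h :
  (forall m, h (f (g m)) = c *: f' (g' (h m))) ->
  forall m, h (one_plus a f g m) = one_plus (a * c) f' g' (h m).
Proof. by move=> hfg m; rewrite /one_plus linearD linearZ /= hfg scalerA. Qed.

Lemma one_plus_comm a f g h : (forall m, h (f (g m)) = f (g (h m))) ->
  forall m, h (one_plus a f g m) = one_plus a f g (h m).
Proof.
by move=> hfg m; rewrite /one_plus linearD linearZ /= hfg.
Qed.

Variables (a : F) (f g : {linear M -> M}).
Hypothesis f2 : forall m, f (f m) = m.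
Hypothesis g2 : forall m, g (g m) = m.
Hypothesis fg : forall m, f (g m) = - g (f m).
Hypothesis a2 : a * a = 1.

(** For anticommuting f and g of square 1 and a = +-1 one has
    f (1 + a f g) = a (1 + a f g) g and g (1 + a f g) = - a (1 + a f g) f: the factor
    exchanges f and g up to sign, just as a reflection does with two letters. *)
Lemma one_plus_swapl m : f (one_plus a f g m) = a *: one_plus a f g (g m).
Proof.
by rewrite /one_plus linearD linearZ /= f2 g2 scalerDr scalerA a2 scale1r addrC.
Qed.

Lemma one_plus_swapr m : g (one_plus a f g m) = - a *: one_plus a f g (f m).
Proof.
have gfg m' : g (f (g m')) = - f m' by rewrite fg linearN /= g2.
have fgf m' : f (g (f m')) = - g m' by rewrite fg f2.
rewrite /one_plus linearD linearZ /= gfg fgf !scalerN scalerBr scalerA.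
by rewrite !mulNr a2 scaleNr addrC scaleN1r opprK.
Qed.

End OnePlusTheory.

Section Operators.
Variables (F : fieldType) (n : nat) (M : lmodType F).
Local Notation op := {linear M -> M}.
Implicit Types (G : {set {perm sletter n}}) (m : M) (i j k : 'I_n).

Record cw_rep G (C E : 'I_n -> op) (Wo : {perm sletter n} -> op) : Prop := {
  rep_w1 m : Wo 1%g m = m;
  rep_wM s1 s2 m : s1 \in G -> s2 \in G -> Wo s1 (Wo s2 m) = Wo (s2 * s1)%g m;
  rep_c2 i m : C i (C i m) = m;
  rep_e2 i m : E i (E i m) = m;
  rep_cc i j m : i != j -> C i (C j m) = - C j (C i m);
  rep_ee i j m : i != j -> E i (E j m) = - E j (E i m);
  rep_ce i j m : C i (E j m) = - E j (C i m);
  rep_wc s i m : s \in G -> Wo s (C i m) = (-1) ^+ ssgn s i *: C (spos s i) (Wo s m);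
  rep_we s i m : s \in G -> Wo s (E i m) = (-1) ^+ ssgn s i *: E (spos s i) (Wo s m)
}.

(** With d = false these are the terms of [y_i, x_j] and with d = true those of
    [y_i, x_i] indexed by j; c_j c_i and - c_i c_j being equal, the two
    kinds of terms differ only by a sign in the first factor. *)
Definition crossing (C E : 'I_n -> M -> M) (Wo : {perm sletter n} -> M -> M)
    (b d : bool) i j m : M :=
  one_plus ((-1) ^+ (b (+) d)) (C i) (C j)
    (one_plus ((-1) ^+ b) (E j) (E i) (Wo (refl b i j) m)).

(** The defining relations of H, for operators on a module.  The coefficients
    [uu false] and [uu true] are those of the terms in s_ij and in their barred versions:
    thus [uu true] is 0 in type A and equals [uu false] in types B and D, and v is 0
    except in type B. *)
Record hcc_rep G (t : F) (uu : bool -> F) (v : F) (X Y C E : 'I_n -> op)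
    (Wo : {perm sletter n} -> op) : Prop := {
  rep_cw : cw_rep G C E Wo;
  rep_xx i j m : X i (X j m) = X j (X i m);
  rep_yy i j m : Y i (Y j m) = Y j (Y i m);
  rep_wx s i m : s \in G -> Wo s (X i m) = (-1) ^+ ssgn s i *: X (spos s i) (Wo s m);
  rep_wy s i m : s \in G -> Wo s (Y i m) = (-1) ^+ ssgn s i *: Y (spos s i) (Wo s m);
  rep_ex i j m : E i (X j m) = X j (E i m);
  rep_cx i j m : C i (X j m) = (-1) ^+ (i == j) *: X j (C i m);
  rep_cy i j m : C i (Y j m) = Y j (C i m);
  rep_ey i j m : E i (Y j m) = (-1) ^+ (i == j) *: Y j (E i m);
  rep_yx i j m : i != j -> Y i (X j m) = X j (Y i m) +
     \sum_(b : bool) ((-1) ^+ b * uu b) *: crossing C E Wo b false i j m;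
  rep_yxd i m : Y i (X i m) = X i (Y i m) + t *: C i (E i m)
     - \sum_(b : bool) uu b *: (\sum_(k | k != i) crossing C E Wo b true i k m)
     - v *: Wo (tau_ i) m
}.

Section CW.
Variables (G : {group {perm sletter n}}) (C E : 'I_n -> op).
Variable Wo : {perm sletter n} -> op.
Hypothesis GB : G \subset WB n.
Hypothesis cw : cw_rep G C E Wo.
Local Notation P := (crossing C E Wo).

Lemma crossing_is_linear b d i j : linear (P b d i j).
Proof. by move=> a m m'; rewrite /crossing !linearP. Qed.
HB.instance Definition _ b d i j :=
  GRing.isLinear.Build F M M *:%R (P b d i j) (crossing_is_linear b d i j).

Lemma sign2 b : (-1) ^+ b * (-1) ^+ b = 1 :> F.
Proof. by rewrite -expr2 sqrr_sign. Qed.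

Lemma rep_ecc i j k m : E k (C i (C j m)) = C i (C j (E k m)).
Proof.
have ec l m' : E k (C l m') = - C l (E k m') by rewrite (rep_ce cw) opprK.
by rewrite ec ec linearN opprK.
Qed.

Lemma rep_cee i j k m : C k (E i (E j m)) = E i (E j (C k m)).
Proof. by rewrite (rep_ce cw) (rep_ce cw) linearN opprK. Qed.

Lemma rep_ccc i j k m : k != i -> k != j -> C k (C i (C j m)) = C i (C j (C k m)).
Proof. by move=> ki kj; rewrite (rep_cc cw) // (rep_cc cw _ kj) linearN opprK. Qed.

Lemma rep_eee i j k m : k != i -> k != j -> E k (E i (E j m)) = E i (E j (E k m)).
Proof. by move=> ki kj; rewrite (rep_ee cw) // (rep_ee cw _ kj) linearN opprK. Qed.

Lemma rep_refl (V : 'I_n -> op) b i j k m : refl b i j \in G ->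
  (forall s i m, s \in G -> Wo s (V i m) = (-1) ^+ ssgn s i *: V (spos s i) (Wo s m)) ->
  V k (Wo (refl b i j) m) = (-1) ^+ (b && ((k == i) || (k == j)))
    *: Wo (refl b i j) (V (tperm i j k) m).
Proof.
move=> rG wV; rewrite wV // spos_refl tpermK ssgn_refl scalerA.
suff -> : (tperm i j k == i) || (tperm i j k == j) = (k == i) || (k == j).
  by rewrite sign2 scale1r.
by case: tpermP => [->|->|]; rewrite ?eqxx ?orbT.
Qed.

(** On its way through the crossing c_k has its index exchanged twice, once by the
    Clifford factor and once by the reflection; only a sign survives. *)
Lemma crossing_C b d i j k m : i != j -> refl b i j \in G ->
  C k (P b d i j m) = (-1) ^+ (k == if d then i else j) *: P b d i j (C k m).
Proof.
move=> ij rG; rewrite /crossing.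
have cE k' m' : C k' (one_plus ((-1) ^+ b) (E j) (E i) m')
    = one_plus ((-1) ^+ b) (E j) (E i) (C k' m').
  by apply: (@one_plus_comm _ _ _ _ _ (C k')) => ?; rewrite rep_cee.
have ccij m' : C i (C j m') = - C j (C i m') by apply: (rep_cc cw).
have [->|ki] := eqVneq k i.
  rewrite one_plus_swapl ?sign2 //; try exact: (rep_c2 cw).
  rewrite cE (rep_refl _ _ rG (rep_wc cw)) tpermR eqxx orbT !linearZ /=.
  rewrite andbT scalerA -signr_addb.
  by rewrite addKb; case: (d); rewrite ?eqxx ?(negPf ij).
have [->|kj] := eqVneq k j.
  rewrite one_plus_swapr ?sign2 //; try exact: (rep_c2 cw).
  rewrite cE (rep_refl _ _ rG (rep_wc cw)) tpermL eqxx !linearZ /=.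
  rewrite andbT scalerA mulrN -signr_addb addKb.
  by case: (d); rewrite ?eqxx ?[j == i]eq_sym ?(negPf ij) //= opprK.
rewrite (@one_plus_comm _ _ _ _ _ (C k)); last by move=> ?; rewrite rep_ccc.
rewrite cE (rep_refl _ _ rG (rep_wc cw)) (negPf ki) (negPf kj) andbF scale1r.
by rewrite tpermD ?[_ == k]eq_sym //; case: (d); rewrite ?(negPf ki) ?(negPf kj) scale1r.
Qed.

Lemma crossing_E b d i j k m : i != j -> refl b i j \in G ->
  E k (P b d i j m) = (-1) ^+ (k == i) *: P b d i j (E k m).
Proof.
move=> ij rG; rewrite /crossing.
rewrite (@one_plus_comm _ _ _ _ _ (E k)); last by move=> ?; rewrite rep_ecc.
have eeji m' : E j (E i m') = - E i (E j m') by apply: (rep_ee cw); rewrite eq_sym.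
have [->|ki] := eqVneq k i.
  rewrite one_plus_swapr ?sign2 //; try exact: (rep_e2 cw).
  rewrite (rep_refl _ _ rG (rep_we cw)) tpermR eqxx orbT !linearZ /= andbT.
  by rewrite scalerA mulNr sign2.
have [->|kj] := eqVneq k j.
  rewrite one_plus_swapl ?sign2 //; try exact: (rep_e2 cw).
  by rewrite (rep_refl _ _ rG (rep_we cw)) tpermL eqxx !linearZ /= andbT scalerA sign2.
rewrite (@one_plus_comm _ _ _ _ _ (E k)); last by move=> ?; rewrite rep_eee.
rewrite (rep_refl _ _ rG (rep_we cw)) (negPf ki) (negPf kj) andbF !scale1r.
by rewrite tpermD ?[_ == k]eq_sym.
Qed.

Lemma crossing_W s b d i j m : s \in G -> refl b i j \in G ->
  let b' := b (+) ssgn s i (+) ssgn s j in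
  Wo s (P b d i j m) = P b' d (spos s i) (spos s j) (Wo s m).
Proof.
move=> sG rG b'; have sB : s \in WB n := subsetP GB s sG.
have rr := refl_mull b i j sB.
have r'G : refl b' (spos s i) (spos s j) \in G.
  by rewrite -(groupMl _ sG) -rr groupM.
have ww : Wo s (Wo (refl b i j) m) = Wo (refl b' (spos s i) (spos s j)) (Wo s m).
  by rewrite !(rep_wM cw) // rr.
rewrite /crossing.
have sgn2 k l : (-1) ^+ ssgn s k * (-1) ^+ ssgn s l = (-1) ^+ (ssgn s k (+) ssgn s l) :> F.
  by rewrite signr_addb.
rewrite (@one_plus_twist _ _ _ ((-1) ^+ (ssgn s i (+) ssgn s j)) _ _
  (C (spos s i)) (C (spos s j)) (Wo s)); last first.
  by move=> m'; rewrite (rep_wc cw) // (rep_wc cw) // linearZ /= scalerA sgn2.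
rewrite (@one_plus_twist _ _ _ ((-1) ^+ (ssgn s i (+) ssgn s j)) _ _
  (E (spos s j)) (E (spos s i)) (Wo s)); last first.
  by move=> m'; rewrite (rep_we cw) // (rep_we cw) // linearZ /= scalerA sgn2 addbC.
by rewrite ww -!signr_addb !addbA [b (+) d (+) _]addbAC [_ (+) d (+) _]addbAC.
Qed.

(** Exchanging c and e reverses the two indices: this is what makes the
    presentation symmetric in x and y. *)
Lemma crossingC_swap b i j m : i != j -> crossing E C Wo b false i j m =
  P b false j i m.
Proof.
move=> ij; rewrite /crossing !addbF reflC.
rewrite (@one_plus_comm _ _ _ _ _ (one_plus ((-1) ^+ b) (C j) (C i))) //.
move=> m'; rewrite /one_plus !linearD !linearZ /=.
by rewrite rep_ecc (rep_ecc j i i).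
Qed.

Lemma crossingC_swap_diag b i j m : i != j -> crossing E C Wo b true i j m =
  P b true i j m.
Proof.
move=> ij; rewrite /crossing !addbT.
have flipE m' : one_plus ((-1) ^+ ~~ b) (E i) (E j) m' = one_plus ((-1) ^+ b) (E j) (E i) m'.
  by rewrite /one_plus (rep_ee cw _ ij) scalerN -scaleNr signrN opprK.
have flipC m' : one_plus ((-1) ^+ b) (C j) (C i) m' = one_plus ((-1) ^+ ~~ b) (C i) (C j) m'.
  by rewrite /one_plus (rep_cc cw _ ij) scalerN -scaleNr signrN opprK.
rewrite flipE flipC (@one_plus_comm _ _ _ _ _ (one_plus ((-1) ^+ b) (E j) (E i))) //.
by move=> m0 /=; rewrite /one_plus rep_ecc rep_ecc !linearD !linearZ.
Qed.

Lemma cw_rep_swap : cw_rep G E C Wo.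
Proof.
case: cw => w1 wM c2 e2 cc ee ce wc we; split=> // i j m.
by rewrite ce opprK.
Qed.

End CW.

(** Since [x_i, y_j] = - [y_j, x_i], the signs of u and v change; that of t does
    not, because e_i c_i = - c_i e_i absorbs it. *)
Lemma hcc_rep_swap (G : {group {perm sletter n}}) t uu v X Y C E Wo :
  hcc_rep G t uu v X Y C E Wo ->
  hcc_rep G t (fun b => - uu b) (- v) Y X E C Wo.
Proof.
case=> cw xx yy wx wy ex cx cy ey yx yxd; split=> //.
- exact: cw_rep_swap cw.
- move=> i j m ij; rewrite yx 1?eq_sym // -addrA -big_split /= big1 ?addr0 // => b _.
  by rewrite (crossingC_swap cw _ _ ij) mulrN scaleNr subrr.
- move=> i m; rewrite yxd (rep_ce cw) scalerN.
  under [X in _ = _ - X - _]eq_bigr => b _.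
    rewrite scaleNr; under eq_bigr => k ki do rewrite (crossingC_swap_diag cw) 1?eq_sym //.
    over.
  rewrite sumrN scaleNr !opprK.
  set a := X i _; set p := t *: _; set q := \sum_b _; set r := v *: _.
  by rewrite (addrAC _ _ p) (addrAC _ _ p) subrK (addrAC _ _ q) !subrK.
Qed.

End Operators.

(** * Relations that follow from the commutators of the y with the x *)

(** The y_i are operators which kill the space vac and have the
    prescribed commutators with the x_j, while vac and the x_j span the module.
    So operators with the same commutation rules with the x_j coincide as soon as
    they coincide on vac, and the relations among the y, c, e and w reduce to
    relations among the commutators. *)
Section StandardModule.
Variables (F : fieldType) (n : nat) (M : lmodType F).
Local Notation op := {linear M -> M}.
Implicit Types (m : M) (i j k l : 'I_n) (b d : bool).
Variables (t v : F) (uu : bool -> F).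
Variables (X Y C E : 'I_n -> op) (Wo : {perm sletter n} -> op).
Variable vac : M -> Prop.
Local Notation P := (crossing C E Wo).

Hypothesis cw : cw_rep (WB n) C E Wo.
Hypothesis xx : forall i j m, X i (X j m) = X j (X i m).
Hypothesis wx : forall s i m, s \in WB n ->
  Wo s (X i m) = (-1) ^+ ssgn s i *: X (spos s i) (Wo s m).
Hypothesis ex : forall i j m, E i (X j m) = X j (E i m).
Hypothesis cx : forall i j m, C i (X j m) = (-1) ^+ (i == j) *: X j (C i m).
Hypothesis vac_ind : forall Q : M -> Prop,
  (forall m, vac m -> Q m) -> (forall m m', Q m -> Q m' -> Q (m + m')) ->
  (forall i m, Q m -> Q (X i m)) -> forall m, Q m.
Hypothesis vacC : forall i m, vac m -> vac (C i m).
Hypothesis vacE : forall i m, vac m -> vac (E i m).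
Hypothesis vacW : forall s m, vac m -> vac (Wo s m).
Hypothesis vacY : forall i m, vac m -> Y i m = 0.

Definition yx_bracket i j m : M :=
  if i == j then
    t *: C i (E i m) - \sum_(b : bool) uu b *: (\sum_(k | k != i) P b true i k m)
      - v *: Wo (tau_ i) m
  else \sum_(b : bool) ((-1) ^+ b * uu b) *: P b false i j m.
Local Notation K := yx_bracket.

Hypothesis yxK : forall i j m, Y i (X j m) = X j (Y i m) + K i j m.

Let linP b d i j := crossing_is_linear C E Wo b d i j.
HB.instance Definition _ b d i j :=
  GRing.isLinear.Build F M M *:%R (P b d i j) (linP b d i j).

(* In the context, so that the membership conditions of the crossing lemmas below
   are closed by assumption. *)
Let reflB b i j : refl b i j \in WB n := refl_WB b i j.

Lemma bracket_C i j k m : C k (K i j m) = (-1) ^+ (k == j) *: K i j (C k m).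
Proof.
rewrite /yx_bracket; case: eqVneq => [<-|ij]; last first.
  rewrite linear_sum scaler_sumr; apply: eq_bigr => b _ /=.
  by rewrite linearZ /= (crossing_C cw) // !scalerA mulrC.
rewrite [LHS]linearB [C k (_ - _)]linearB !scalerBr [C k (t *: _)]linearZ
  [C k (v *: _)]linearZ linear_sum /= !scalerA.
congr (_ - _ - _).
- have [->|ki] := eqVneq k i.
    by rewrite (rep_c2 cw) (rep_ce cw) (rep_c2 cw) scalerN mulN1r scaleNr opprK.
  by rewrite (rep_cc cw _ ki) (rep_ce cw) [C i (- _)]linearN opprK mul1r.
- rewrite scaler_sumr; apply: eq_bigr => b _; rewrite linearZ /= scalerA mulrC -scalerA.
  congr (_ *: _); rewrite linear_sum scaler_sumr; apply: eq_bigr => l li.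
  by rewrite (crossing_C cw) // eq_sym.
- rewrite (rep_wc cw) ?tau_WB // spos_tau ssgn_tau scalerA mulrAC.
  by rewrite sign2 mul1r.
Qed.

Lemma bracket_E i j k m : E k (K i j m) = (-1) ^+ (k == i) *: K i j (E k m).
Proof.
rewrite /yx_bracket; case: eqVneq => [_|ij]; last first.
  rewrite linear_sum scaler_sumr; apply: eq_bigr => b _ /=.
  by rewrite linearZ /= (crossing_E cw) // !scalerA mulrC.
have ec l l' m' : E l (C l' m') = - C l' (E l m') by rewrite (rep_ce cw) opprK.
rewrite [LHS]linearB [E k (_ - _)]linearB !scalerBr [E k (t *: _)]linearZ
  [E k (v *: _)]linearZ linear_sum /= !scalerA.
congr (_ - _ - _).
- have [->|ki] := eqVneq k i.
    by rewrite ec (rep_e2 cw) scalerN mulN1r scaleNr.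
  by rewrite ec (rep_ee cw _ ki) [C i (- _)]linearN opprK mul1r.
- rewrite scaler_sumr; apply: eq_bigr => b _; rewrite linearZ /= scalerA mulrC -scalerA.
  congr (_ *: _); rewrite linear_sum scaler_sumr; apply: eq_bigr => l li.
  by rewrite (crossing_E cw) // eq_sym.
- rewrite (rep_we cw) ?tau_WB // spos_tau ssgn_tau scalerA mulrAC.
  by rewrite sign2 mul1r.
Qed.

(** A change of sign of one of the two indices exchanges s_ij and its barred
    version; hence the condition on uu. *)
Lemma bracket_W s i j m : s \in WB n ->
  (forall b k l, uu (b (+) ssgn s k (+) ssgn s l) = uu b) ->
  Wo s (K i j m) = (-1) ^+ (ssgn s i (+) ssgn s j) *: K (spos s i) (spos s j) (Wo s m).
Proof.
move=> sB uus; rewrite /yx_bracket (inj_eq (spos_inj sB)).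
case: eqVneq => [<-|ij]; last first.
  rewrite linear_sum scaler_sumr [RHS](reindex_inj (@addIb (ssgn s i (+) ssgn s j))) /=.
  apply: eq_bigr => b _; rewrite linearZ /= (crossing_W (subxx _) cw) // scalerA.
  rewrite addbA uus mulrA -signr_addb; congr ((_ ^+ nat_of_bool _ * _) *: _).
  by case: b (ssgn s i) (ssgn s j) => [] [] [].
rewrite addbb scale1r [LHS]linearB [Wo s (_ - _)]linearB [Wo s (t *: _)]linearZ
  [Wo s (v *: _)]linearZ linear_sum /=; congr (_ - _ - _).
- rewrite (rep_wc cw) // (rep_we cw) // [C _ (_ *: _)]linearZ /= !scalerA -mulrA.
  by rewrite -signr_addb addbb mulr1.
- under eq_bigr => b _ do rewrite linearZ /= linear_sum scaler_sumr.
  under [RHS]eq_bigr => b _ do rewrite scaler_sumr.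
  rewrite exchange_big [RHS]exchange_big [RHS](reindex_inj (spos_inj sB)) /=.
  apply: eq_big => [k|k ki]; first by rewrite (inj_eq (spos_inj sB)).
  rewrite [RHS](reindex_inj (@addIb (ssgn s i (+) ssgn s k))) /=.
  apply: eq_bigr => b _; rewrite (crossing_W (subxx _) cw) //.
  by rewrite addbA uus.
- by rewrite !(rep_wM cw) ?tau_WB // tau_mull.
Qed.

Lemma standard_cy i k m : C k (Y i m) = Y i (C k m).
Proof.
elim/vac_ind: m => [m vm|m m' IH IH'|j m IH].
- by rewrite !vacY ?linear0 //; apply: vacC.
- by rewrite !linearD IH IH'.
- rewrite yxK linearD /= cx IH bracket_C cx linearZ /= yxK.
  by rewrite scalerDr.
Qed.

Lemma standard_ey i k m : E k (Y i m) = (-1) ^+ (k == i) *: Y i (E k m).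
Proof.
elim/vac_ind: m => [m vm|m m' IH IH'|j m IH].
- by rewrite !vacY ?linear0 ?scaler0 //; apply: vacE.
- by rewrite !linearD IH IH' /=.
- by rewrite yxK linearD /= ex IH bracket_E ex yxK scalerDr linearZ.
Qed.

Lemma standard_wy s i m : s \in WB n ->
  (forall b k l, uu (b (+) ssgn s k (+) ssgn s l) = uu b) ->
  Wo s (Y i m) = (-1) ^+ ssgn s i *: Y (spos s i) (Wo s m).
Proof.
move=> sB uus; elim/vac_ind: m => [m vm|m m' IH IH'|j m IH].
- by rewrite !vacY ?linear0 ?scaler0 //; apply: vacW.
- by rewrite !linearD IH IH' /=.
- rewrite yxK linearD /= wx // IH bracket_W // wx // !linearZ /= yxK.
  by rewrite !scalerDr !scalerA -!signr_addb addbC.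
Qed.

Section Crossing.
Variables (b : bool) (i j : 'I_n).
Hypothesis ij : i != j.
Hypothesis rY : forall k m, Wo (refl b i j) (Y k m) =
  (-1) ^+ (b && ((k == i) || (k == j))) *: Y (tperm i j k) (Wo (refl b i j) m).

Let Ycc k i' j' m : Y k (C i' (C j' m)) = C i' (C j' (Y k m)).
Proof. by rewrite -!standard_cy. Qed.

Let Yee k i' j' m :
  E i' (E j' (Y k m)) = (-1) ^+ ((i' == k) (+) (j' == k)) *: Y k (E i' (E j' m)).
Proof.
by rewrite standard_ey [E i' (_ *: _)]linearZ /= standard_ey scalerA -signr_addb addbC.
Qed.

Lemma crossing_Y d k m : k != i -> k != j -> P b d i j (Y k m) = Y k (P b d i j m).
Proof.
move=> ki kj; rewrite /crossing.
rewrite rY (negPf ki) (negPf kj) andbF scale1r tpermD ?[_ == k]eq_sym //.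
have eeY m' : one_plus ((-1) ^+ b) (E j) (E i) (Y k m') =
    Y k (one_plus ((-1) ^+ b) (E j) (E i) m').
  rewrite /one_plus linearD linearZ /= Yee ![_ == k]eq_sym.
  by rewrite (negPf ki) (negPf kj) scale1r.
by rewrite eeY (@one_plus_comm _ _ _ (C i) (C j) (Y k)) // => m'; rewrite Ycc.
Qed.

Let eeY1 k c m : (k == i) || (k == j) ->
  one_plus c (E j) (E i) (Y k m) = Y k (one_plus (- c) (E j) (E i) m).
Proof.
move=> kij; rewrite /one_plus linearD linearZ /= Yee.
have -> : (j == k) (+) (i == k).
  by case/orP: kij => /eqP->; rewrite eqxx ?[j == i]eq_sym (negPf ij).
by rewrite expr1 scaleN1r scalerN scaleNr.
Qed.

Let flip d m : P b d j i m =
  one_plus ((-1) ^+ (b (+) ~~ d)) (C i) (C j)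
    (one_plus (- (-1) ^+ b) (E j) (E i) (Wo (refl b i j) m)).
Proof.
have ji : j != i by rewrite eq_sym.
rewrite /crossing reflC /one_plus (rep_ee cw _ ij) scalerN -scaleNr.
by rewrite (rep_cc cw _ ji) scalerN -scaleNr addbN signrN.
Qed.

(** The two terms of [K i j, y_j] and of [K j j, y_i] that do not cancel on the
    spot match each other, by this lemma and the next one. *)
Lemma crossing_flipY m : (-1) ^+ b *: P b false i j (Y j m) = Y i (P b true j i m).
Proof.
rewrite flip /crossing rY eqxx orbT andbT tpermR /= !addbF !linearZ /=.
rewrite scalerA sign2 scale1r eeY1 ?eqxx //.
by rewrite -(@one_plus_comm _ _ _ (C i) (C j) (Y i)) // => m'; rewrite Ycc.
Qed.

Lemma crossing_Yflip m : P b true j i (Y i m) = (-1) ^+ b *: Y j (P b false i j m).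
Proof.
rewrite flip /crossing rY eqxx andbT tpermL /= !addbF !linearZ /=.
rewrite eeY1 ?eqxx ?orbT // opprK.
by rewrite -(@one_plus_comm _ _ _ (C i) (C j) (Y j)) // => m'; rewrite Ycc.
Qed.
End Crossing.

Hypothesis uuT : uu true = 0 \/ uu true = uu false.
Hypothesis vT : v = 0 \/ uu true = uu false.

Let uuC b b' : uu true = uu false -> uu b = uu b'.
Proof. by case: b b' => [] []. Qed.

Lemma refl_Y b i j k m : uu b != 0 -> Wo (refl b i j) (Y k m) =
  (-1) ^+ (b && ((k == i) || (k == j))) *: Y (tperm i j k) (Wo (refl b i j) m).
Proof.
move=> ub; rewrite standard_wy ?refl_WB ?ssgn_refl ?spos_refl // => b' k' l'.
case: uuT => [u0|uE]; last exact: uuC.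
by case: b ub => [|_]; rewrite ?u0 ?eqxx // !ssgn_refl !addbF.
Qed.

Lemma tau_Y i k m : k != i -> v *: Wo (tau_ i) (Y k m) = v *: Y k (Wo (tau_ i) m).
Proof.
move=> ki; case: vT => [->|uE]; first by rewrite !scale0r.
rewrite standard_wy ?tau_WB //; last by move=> *; apply: uuC.
by rewrite spos_tau ssgn_tau (negPf ki) scale1r.
Qed.

Lemma bracket_Y i k j m : i != j -> k != j -> i != k -> K i k (Y j m) = Y j (K i k m).
Proof.
move=> ij kj ik; rewrite /yx_bracket (negPf ik) linear_sum; apply: eq_bigr => b _.
rewrite linearZ /=; have [->|ub] := eqVneq (uu b) 0; first by rewrite mulr0 !scale0r.
congr (_ *: _); apply: crossing_Y => //; last by rewrite eq_sym.
  by move=> *; apply: refl_Y.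
by rewrite eq_sym.
Qed.

(** The Jacobi identity for y_i, y_j and x_k.  No three-term identity is needed:
    for k distinct from i and j each of the four products commutes separately, and
    for k = j only the terms indexed by the pair i, j remain. *)
Lemma bracket_YY i j k m : i != j ->
  K i k (Y j m) + Y i (K j k m) = K j k (Y i m) + Y j (K i k m).
Proof.
move=> ij; have rearrange (a T YS V SY YK : M) : YS + YK = SY + a ->
    a + (T - YS - V) = T - SY - V + YK.
  move=> /esym/(canRL (addKr _)) ->.
  rewrite (addrC YS YK) !addrA (addrAC _ YS T) addrK [RHS]addrAC.
  by rewrite [- SY + _ + _]addrC addrA.
have main i' j' : i' != j' ->
    K i' j' (Y j' m) + Y i' (K j' j' m) = K j' j' (Y i' m) + Y j' (K i' j' m).
  move=> ij'; have ji : j' != i' by rewrite eq_sym.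
  rewrite /yx_bracket (negPf ij') eqxx.
  rewrite [Y i' (_ - _)]linearB [Y i' (_ - _)]linearB [Y i' (t *: _)]linearZ
    [Y i' (v *: _)]linearZ /=.
  rewrite -standard_cy -(tau_Y _ ij').
  have -> : Y i' (E j' m) = E j' (Y i' m) by rewrite standard_ey (negPf ji) scale1r.
  apply: rearrange; rewrite !linear_sum -!big_split /=; apply: eq_bigr => b _.
  have [->|ub] := eqVneq (uu b) 0; first by rewrite mulr0 !scale0r !linear0.
  have rY := refl_Y i' j' _ _ ub.
  rewrite [Y i' (uu b *: _)]linearZ [Y j' (_ *: _)]linearZ /=.
  rewrite (bigD1 i') //= [in RHS](bigD1 i') //= linearD scalerDr [in RHS]scalerDr.
  rewrite -crossing_flipY // crossing_Yflip // !scalerA [uu b * _]mulrC.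
  rewrite [LHS]addrAC [RHS]addrAC; congr (_ + _); first by rewrite addrC.
  congr (_ *: _); rewrite linear_sum; apply: eq_bigr => l /andP[lj li].
  symmetry; apply: crossing_Y => //; by [rewrite eq_sym | move=> *; apply: refl_Y].
have [->|kj] := eqVneq k j; first exact: main.
have [->|ki] := eqVneq k i; first by symmetry; apply: main; rewrite eq_sym.
have [jk ik ji] : [/\ j != k, i != k & j != i].
  by split; rewrite // eq_sym.
by rewrite bracket_Y // bracket_Y // addrC.
Qed.

Lemma standard_yy i j m : Y i (Y j m) = Y j (Y i m).
Proof.
have [->//|ij] := eqVneq i j.
elim/vac_ind: m => [m vm|m m' IH IH'|k m IH].
- by rewrite (vacY j vm) (vacY i vm) !linear0.
- by rewrite !linearD IH IH'.
- by rewrite !yxK !linearD !yxK IH -!addrA bracket_YY.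
Qed.

Lemma standard_rep (G : {group {perm sletter n}}) : G \subset WB n ->
  (forall s, s \in G -> forall b k l, uu (b (+) ssgn s k (+) ssgn s l) = uu b) ->
  hcc_rep G t uu v X Y C E Wo.
Proof.
move=> GB uus; have inB s : s \in G -> s \in WB n by apply: (subsetP GB).
split=> //.
- case: cw => w1 wM c2 e2 cc ee ce wc we; split=> //.
  + by move=> s1 s2 m /inB s1B /inB; apply: wM.
  + by move=> s i m /inB; apply: wc.
  + by move=> s i m /inB; apply: we.
- exact: standard_yy.
- by move=> s i m sG; rewrite wx // inB.
- by move=> s i m sG; rewrite standard_wy ?inB //; apply: uus.
- by move=> i j m; rewrite standard_cy.
- by move=> i j m; rewrite standard_ey.
- by move=> i j m ij; rewrite yxK /yx_bracket (negPf ij).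
- by move=> i m; rewrite yxK /yx_bracket eqxx !addrA.
Qed.

End StandardModule.

(** * Dunkl operators *)

Section Dunkl.
Variables (F : fieldType) (n : nat) (M : lmodType F).
Local Notation op := {linear M -> M}.
Implicit Types (m : M) (i j k l : 'I_n) (s : {perm sletter n}).
Variables (t v : F) (uu : bool -> F).
Variables (X clc cle : 'I_n -> op) (act sh : {perm sletter n} -> op).
Variables (tD : 'I_n -> op) (rD : bool -> 'I_n -> 'I_n -> op).
Variables (C E : 'I_n -> op) (Wo : {perm sletter n} -> op).
Hypothesis X_c : forall i j m, clc i (X j m) = X j (clc i m).
Hypothesis X_e : forall i j m, cle i (X j m) = X j (cle i m).
Hypothesis X_s : forall s j m, sh s (X j m) = X j (sh s m).
Hypothesis act_c : forall s i m, clc i (act s m) = act s (clc i m).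
Hypothesis act_e : forall s i m, cle i (act s m) = act s (cle i m).
Hypothesis actM : forall s s' m, s' \in WB n -> act s' (act s m) = act (s * s')%g m.
Hypothesis CE : forall i m, C i m = act (tau_ i) (clc i m).
Hypothesis EE : forall i m, E i m = cle i m.
Hypothesis WE : forall s m, Wo s m = act s (sh s m).
Hypothesis tDX : forall i j m,
  tD i (X j m) = X j (tD i m) + (j == i)%:R *: act (tau_ i) m.
Hypothesis rDX : forall b i k j m, i != k ->
  rD b i k (X j m) = X j (rD b i k m) + rcoef F b i k j *: act (refl b i k) m.

Definition pre_cross (b : bool) i k m : M :=
  one_plus ((-1) ^+ b) (cle k) (cle i) (sh (refl b i k) m).
Fact pre_cross_is_linear b i k : linear (pre_cross b i k).
Proof. by move=> c m m'; rewrite /pre_cross !linearP. Qed.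
HB.instance Definition _ b i k :=
  GRing.isLinear.Build F M M *:%R (pre_cross b i k) (pre_cross_is_linear b i k).

(** Here [clc], [cle] and [sh] are the operators of c, e and w on V, extended to
    polynomials with values in V; they commute with the x_j.  The reflection in
    x_i +- x_k occurs twice in the commutators: in the reflection itself and, for
    the opposite sign, in its product with c_i c_k. *)
Definition dunkl_term (b : bool) i k m : M :=
  (-1) ^+ b *: rD (~~ b) i k (clc i (clc k (pre_cross b i k m)))
       - rD b i k (pre_cross b i k m).
Fact dunkl_term_is_linear b i k : linear (dunkl_term b i k).
Proof.
move=> c m m'; rewrite /dunkl_term !linearP /=.
by rewrite addrACA !scalerA [c * _]mulrC.
Qed.
HB.instance Definition _ b i k :=
  GRing.isLinear.Build F M M *:%R (dunkl_term b i k) (dunkl_term_is_linear b i k).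

Definition dunkl i m : M :=
  t *: tD i (clc i (cle i m))
  + \sum_(b : bool) uu b *: (\sum_(k | k != i) dunkl_term b i k m)
  - v *: tD i (sh (tau_ i) m).

Fact dunkl_is_linear i : linear (dunkl i).
Proof.
move=> c m m'; rewrite /dunkl !linearP /=.
under eq_bigr => b _.
  under eq_bigr => k _ do rewrite linearP.
  rewrite big_split /= -scaler_sumr scalerDr scalerA mulrC -scalerA; over.
rewrite big_split /= -scaler_sumr [in RHS]scalerDr [in RHS]scalerDr [RHS]addrACA.
by congr (_ + _); apply: addrACA.
Qed.
HB.instance Definition _ i :=
  GRing.isLinear.Build F M M *:%R (dunkl i) (dunkl_is_linear i).

Local Notation P := (crossing C E Wo).

Lemma crossing_expand b d i k m : i != k ->
  P b d i k m = act (refl b i k) (pre_cross b i k m) +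
    (-1) ^+ (b (+) d) *:
      act (refl (~~ b) i k) (clc i (clc k (pre_cross b i k m))).
Proof.
move=> ik; rewrite /crossing.
have -> : one_plus ((-1) ^+ b) (E k) (E i) (Wo (refl b i k) m) =
    act (refl b i k) (pre_cross b i k m).
  by rewrite /pre_cross /one_plus WE !EE !act_e linearD linearZ.
rewrite {1}/one_plus; congr (_ + _ *: _).
by rewrite !CE !act_c [act (tau_ k) _]actM ?tau_WB // actM ?tau_WB // tau_tau_refl.
Qed.

Lemma pre_crossX b i k j m : pre_cross b i k (X j m) = X j (pre_cross b i k m).
Proof. by rewrite /pre_cross /one_plus X_s !X_e linearD linearZ. Qed.

(** Each divided difference contributes to the commutator with x_j its value at x_j
    times the reflection; collecting the two contributions gives back the factor
    1 +- c_i c_k of the crossing. *)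
Lemma dunkl_termX b i k j m : i != k ->
  dunkl_term b i k (X j m) = X j (dunkl_term b i k m) +
   if j == i then - P b true i k m else (j == k)%:R *: ((-1) ^+ b *: P b false i k m).
Proof.
move=> ik; rewrite /dunkl_term pre_crossX !X_c !rDX //.
rewrite linearB linearZ /= scalerDr opprD addrACA; congr (_ + _).
rewrite !crossing_expand // /rcoef; case: (eqVneq j i) => [->|_].
  rewrite (negPf ik) !mulr0 !subr0 !scale1r addbT opprD signrN scaleNr opprK.
  by rewrite addrC.
rewrite !sub0r addbF -!mulNr !scalerA; case: eqVneq => _; last first.
  by rewrite !mulr0 !mul0r !scale0r subr0.
rewrite !mulr1 mul1r signrN opprK scalerDr scaleNr opprK scalerA addrC.
by rewrite sign2.
Qed.

Lemma dunklX i j m :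
  dunkl i (X j m) = X j (dunkl i m) + yx_bracket t v uu C E Wo i j m.
Proof.
have sumX : \sum_(b : bool) uu b *: (\sum_(k | k != i) dunkl_term b i k (X j m))
    = X j (\sum_(b : bool) uu b *: (\sum_(k | k != i) dunkl_term b i k m))
    + \sum_(b : bool) uu b *: (\sum_(k | k != i)
        if j == i then - P b true i k m
        else (j == k)%:R *: ((-1) ^+ b *: P b false i k m)).
  rewrite (linear_sum (X j)) -big_split; apply: eq_bigr => b _ /=.
  rewrite [X j (uu b *: _)]linearZ /= (linear_sum (X j)) -scalerDr -big_split; congr (_ *: _).
  by apply: eq_bigr => k ki; rewrite dunkl_termX // eq_sym.
rewrite /dunkl !(X_c, X_e, X_s) !tDX sumX.
rewrite [X j (_ - _)]linearB [X j (_ + _)]linearD.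
rewrite [X j (t *: _)]linearZ [X j (v *: _)]linearZ /= !scalerDr opprD.
rewrite (addrACA (t *: _)) [LHS]addrACA; congr (_ + _).
rewrite /yx_bracket [i == j]eq_sym; have [_|ji] := eqVneq j i.
  rewrite !scale1r CE EE WE; congr (_ + _ - _).
  by rewrite -sumrN; apply: eq_bigr => b _; rewrite sumrN scalerN.
rewrite !scale0r !scaler0 add0r subr0; apply: eq_bigr => b _.
rewrite (bigD1 j) //= eqxx scale1r big1 ?addr0 ?scalerA 1?mulrC // => k /andP[_ kj].
by rewrite eq_sym (negPf kj) scale0r.
Qed.

Lemma dunkl_vac (vac : M -> Prop) i m :
  (forall i m, vac m -> vac (clc i m)) ->
  (forall i m, vac m -> vac (cle i m)) -> (forall s m, vac m -> vac (sh s m)) ->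
  (forall b i k m, vac m -> vac (pre_cross b i k m)) ->
  (forall i m, vac m -> tD i m = 0) ->
  (forall b i k m, vac m -> rD b i k m = 0) -> vac m -> dunkl i m = 0.
Proof.
move=> vc ve vs vp tD0 rD0 vm; rewrite /dunkl !tD0; auto.
rewrite !scaler0 add0r subr0 big1 // => b _; rewrite big1 ?scaler0 // => k _.
by rewrite /dunkl_term !rD0 ?scaler0 ?subr0; auto.
Qed.

End Dunkl.

(** * The standard module *)

Section CliffordModel.
Variables (N : nat).
Implicit Types (A : {ffun 'I_N -> bool}) (a b : 'I_N).

Definition toggle a A : {ffun 'I_N -> bool} := [ffun k => A k (+) (k == a)].
(** The Jordan-Wigner sign: toggling b changes the sign seen by a exactly when
    b < a, so of two distinct letters exactly one sees the other. *)
Definition parity a A : bool := \big[addb/false]_(k < N | (k < a)%N) A k.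

Lemma toggleK a A : toggle a (toggle a A) = A.
Proof. by apply/ffunP => k; rewrite !ffunE addbK. Qed.

Lemma toggleC a b A : toggle a (toggle b A) = toggle b (toggle a A).
Proof. by apply/ffunP => k; rewrite !ffunE addbAC. Qed.

Lemma parity_toggle a b A : parity b (toggle a A) = parity b A (+) (a < b)%N.
Proof.
rewrite /parity; under eq_bigr => k _ do rewrite ffunE.
rewrite big_split /=; congr (_ (+) _); have [ab|ab] := boolP (a < b)%N.
  by rewrite (bigD1 a) //= eqxx big1 // => k /andP[_ /negPf].
by rewrite big1 // => k kb; apply: contraNF ab => /eqP <-.
Qed.

End CliffordModel.

Section InducedModule.
Variables (F : fieldType) (n : nat).
Hypothesis F2 : 2%:R != 0 :> F.
Local Notation mp := {mpoly F[n]}.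
(** V consists of the functions on the group W_B times the set of subsets of the
    2n Clifford letters. *)
Definition frame : finType := (subg_of (WB n) * {ffun 'I_(n + n) -> bool})%type.
Definition std_mod : lmodType F := {ffun frame -> mp}.
Local Notation M := std_mod.
Implicit Types (m : M) (i j k l : 'I_n) (s : {perm sletter n}) (z : frame).

Definition pw (f : mp -> mp) m : M := [ffun z => f (m z)].

Lemma pw_linear f : linear f -> linear (pw f).
Proof. by move=> lf c m m'; apply/ffunP => z; rewrite !ffunE lf. Qed.

HB.instance Definition _ (f : {linear mp -> mp}) :=
  GRing.isLinear.Build F M M *:%R (pw f) (pw_linear (@linearP _ _ _ _ f)).

Lemma pw_pw f g m : pw f (pw g m) = pw (f \o g) m.
Proof. by apply/ffunP => z; rewrite !ffunE. Qed.

Lemma eq_pw f g m : f =1 g -> pw f m = pw g m.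
Proof. by move=> fg; apply/ffunP => z; rewrite !ffunE fg. Qed.

(** The letter a_i acts at w in W_B as the letter a_(w i), with its sign.  With this
    twist W acts by translations, and no action of W on the Clifford module has to
    be found. *)
Definition cl (iota : 'I_n -> 'I_(n + n)) i m : M :=
  [ffun z => let a := iota (spos (sgval z.1) i) in
    (-1) ^+ (ssgn (sgval z.1) i (+) parity a z.2) *: m (z.1, toggle a z.2)].

Definition shift s m : M := [ffun z => m ((subg (WB n) s * z.1)%g, z.2)].

Fact cl_is_linear iota i : linear (cl iota i).
Proof.
by move=> c m m'; apply/ffunP => z; rewrite !ffunE /= !ffunE scalerDr !scalerA mulrC.
Qed.
HB.instance Definition _ iota i :=
  GRing.isLinear.Build F M M *:%R (cl iota i) (cl_is_linear iota i).

Fact shift_is_linear s : linear (shift s).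
Proof. by move=> c m m'; apply/ffunP => z; rewrite !ffunE. Qed.
HB.instance Definition _ s :=
  GRing.isLinear.Build F M M *:%R (shift s) (shift_is_linear s).

Lemma cl_pw iota i (f : {linear mp -> mp}) m : cl iota i (pw f m) = pw f (cl iota i m).
Proof. by apply/ffunP => z; rewrite !ffunE /= ffunE linearZ. Qed.

Lemma shift_pw s f m : shift s (pw f m) = pw f (shift s m).
Proof. by apply/ffunP => z; rewrite !ffunE. Qed.

Lemma clK iota i m : cl iota i (cl iota i m) = m.
Proof.
apply/ffunP => -[w A]; rewrite !ffunE /= !ffunE /= toggleK scalerA -signr_addb.
by rewrite parity_toggle ltnn addbF addbb scale1r.
Qed.

Lemma cl_anti iota kappa i j m :
  (forall w, w \in WB n -> iota (spos w i) != kappa (spos w j)) ->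
  cl iota i (cl kappa j m) = - cl kappa j (cl iota i m).
Proof.
move=> ik; apply/ffunP => -[w A]; rewrite !ffunE /= !ffunE /= toggleC !scalerA -!signr_addb.
rewrite -scaleNr -signrN !parity_toggle; congr ((-1) ^+ nat_of_bool _ *: _).
have := ik _ (subgP w); set a := iota _; set b := kappa _ => ab.
have -> : (a < b)%N = ~~ (b < a)%N.
  by rewrite -leqNgt ltn_neqAle; move: ab; rewrite -val_eqE => ->.
by case: (ssgn _ i) (ssgn _ j) (parity a A) (parity b A) (b < a)%N => [] [] [] [] [].
Qed.

Lemma shift1 m : shift 1 m = m.
Proof. by apply/ffunP => -[w A]; rewrite ffunE /= morph1 mul1g. Qed.

Lemma shiftM s1 s2 m : s1 \in WB n -> s2 \in WB n ->
  shift s1 (shift s2 m) = shift (s2 * s1)%g m.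
Proof. by move=> s1B s2B; apply/ffunP => -[w A]; rewrite !ffunE /= morphM // mulgA. Qed.

Lemma shift_cl s iota i m : s \in WB n ->
  shift s (cl iota i m) = (-1) ^+ ssgn s i *: cl iota (spos s i) (shift s m).
Proof.
move=> sB; apply/ffunP => -[w A]; rewrite !ffunE /= subgK //.
by rewrite sposM ?subgP // ssgnM ?subgP // scalerA -signr_addb addbA ffunE.
Qed.

Definition mulX i (f : mp) : mp := 'X_i * f.
Fact mulX_is_linear i : linear (mulX i).
Proof. by move=> c f g; rewrite /mulX mulrDr -scalerAr. Qed.
HB.instance Definition _ i :=
  GRing.isLinear.Build F mp mp *:%R (mulX i) (mulX_is_linear i).

Definition stdX i m : M := pw (mulX i) m.
Definition stdC i m : M := pw (weyl_act (tau_ i)) (cl (@lshift n n) i m).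
Definition stdE i m : M := cl (@rshift n n) i m.
Definition stdW s m : M := pw (weyl_act s) (shift s m).

HB.instance Definition _ i := GRing.Linear.copy (stdX i) (pw (mulX i)).
Fact stdC_is_linear i : linear (stdC i).
Proof.
by move=> c m m'; rewrite /stdC linearP pw_linear //; apply: linearP.
Qed.
HB.instance Definition _ i :=
  GRing.isLinear.Build F M M *:%R (stdC i) (stdC_is_linear i).
HB.instance Definition _ i := GRing.Linear.copy (stdE i) (cl (@rshift n n) i).
Fact stdW_is_linear s : linear (stdW s).
Proof.
by move=> c m m'; rewrite /stdW linearP pw_linear //; apply: linearP.
Qed.
HB.instance Definition _ s :=
  GRing.isLinear.Build F M M *:%R (stdW s) (stdW_is_linear s).

Lemma tau_tau i : (tau_ i * tau_ i)%g = 1%g :> {perm sletter n}.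
Proof.
apply: WB_eqP => [||k|k]; rewrite ?groupM ?tau_WB ?group1 //.
  by rewrite sposM ?tau_WB // !spos_tau spos1.
by rewrite ssgnM ?tau_WB // spos_tau !ssgn_tau addbb ssgn1.
Qed.

Lemma tau_tauC i j : (tau_ i * tau_ j)%g = (tau_ j * tau_ i)%g :> {perm sletter n}.
Proof. by rewrite tau_mull ?tau_WB // spos_tau. Qed.

Lemma std_cw : cw_rep (WB n) stdC stdE stdW.
Proof.
split.
- move=> m; rewrite /= /stdW shift1; apply/ffunP => z; rewrite ffunE.
  exact: weyl_act1.
- move=> s1 s2 m s1B s2B; rewrite /= /stdW shift_pw shiftM // pw_pw.
  by apply: eq_pw => f /=; rewrite weyl_actM.
- move=> i m; rewrite /= /stdC cl_pw clK pw_pw; apply/ffunP => z; rewrite ffunE /=.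
  by rewrite weyl_actM ?tau_WB // tau_tau weyl_act1.
- by move=> i m; rewrite /= /stdE clK.
- move=> i j m ij; rewrite /= /stdC !cl_pw !pw_pw cl_anti; last first.
    by move=> w wB; rewrite (inj_eq (@lshift_inj _ _)) (inj_eq (spos_inj wB)).
  rewrite [LHS]linearN; congr (- _); apply: eq_pw => f /=.
  by rewrite !weyl_actM ?tau_WB // tau_tauC.
- move=> i j m ij; rewrite /= /stdE cl_anti //.
  by move=> w wB; rewrite (inj_eq (@rshift_inj _ _)) (inj_eq (spos_inj wB)).
- move=> i j m; rewrite /= /stdC /stdE cl_pw cl_anti.
    by rewrite [LHS]linearN.
  by move=> w _; rewrite eq_lrshift.
- move=> s i m sB; rewrite /= /stdW /stdC shift_pw cl_pw !pw_pw shift_cl //.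
  rewrite [LHS]linearZ /=; congr (_ *: _); apply: eq_pw => f /=.
  by rewrite !weyl_actM ?tau_WB // tau_mull.
- move=> s i m sB; rewrite /= /stdW /stdE shift_cl // cl_pw.
  by rewrite [LHS]linearZ.
Qed.

Lemma std_xx i j m : stdX i (stdX j m) = stdX j (stdX i m).
Proof. by apply/ffunP => z; rewrite !ffunE /mulX mulrCA. Qed.

Lemma std_wx s i m : s \in WB n ->
  stdW s (stdX i m) = (-1) ^+ ssgn s i *: stdX (spos s i) (stdW s m).
Proof.
move=> sB; apply/ffunP => z; rewrite !ffunE /mulX rmorphM /= weyl_actX.
by rewrite scalerAl.
Qed.

Lemma std_ex i j m : stdE i (stdX j m) = stdX j (stdE i m).
Proof. by rewrite /stdE /stdX cl_pw. Qed.

Lemma std_cx i j m : stdC i (stdX j m) = (-1) ^+ (i == j) *: stdX j (stdC i m).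
Proof.
rewrite /stdC /stdX cl_pw; apply/ffunP => z; rewrite !ffunE /mulX rmorphM /=.
by rewrite weyl_actX spos_tau ssgn_tau scalerAl eq_sym.
Qed.

Definition std_vac m : Prop := forall z, exists c : F, m z = c%:MP.

Lemma std_vac_ind (Q : M -> Prop) :
  (forall m, std_vac m -> Q m) -> (forall m m', Q m -> Q m' -> Q (m + m')) ->
  (forall i m, Q m -> Q (stdX i m)) -> forall m, Q m.
Proof.
move=> Qvac QD QX m.
pose delta z (f : mp) : M := [ffun z' => if z' == z then f else 0].
have Qdelta z f : Q (delta z f).
  elim/mpoly_XU_ind: f => [c|f g Qf Qg|i f Qf].
  - apply: Qvac => z'; rewrite ffunE; case: eqP => _; first by exists c.
    by exists 0; rewrite mpolyC0.
  - suff -> : delta z (f + g) = delta z f + delta z g by apply: QD.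
    by apply/ffunP => z'; rewrite !ffunE; case: eqP => _; rewrite ?addr0.
  - suff -> : delta z ('X_i * f) = stdX i (delta z f) by apply: QX.
    by apply/ffunP => z'; rewrite !ffunE /mulX; case: eqP => _; rewrite ?mulr0.
have -> : m = \sum_z delta z (m z).
  apply/ffunP => z; rewrite sum_ffunE (bigD1 z) //= ffunE eqxx big1 ?addr0 //.
  by move=> z' z'z; rewrite ffunE eq_sym (negPf z'z).
elim/big_rec: _ => [|z m' _ Qm']; last exact: QD.
by apply: Qvac => z; exists 0; rewrite ffunE mpolyC0.
Qed.

Lemma vac_cl iota i m : std_vac m -> std_vac (cl iota i m).
Proof.
move=> vm z; rewrite ffunE /=; case: (vm (z.1, toggle (iota (spos (sgval z.1) i)) z.2)) => c ->.
by rewrite -mul_mpolyC -mpolyCM; eexists.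
Qed.

Lemma vac_shift s m : std_vac m -> std_vac (shift s m).
Proof. by move=> vm z; rewrite ffunE; apply: vm. Qed.

Lemma vac_weyl s m : std_vac m -> std_vac (pw (weyl_act s) m).
Proof.
by move=> vm z; rewrite ffunE; case: (vm z) => c ->; exists c; rewrite weyl_actC.
Qed.

Lemma vac_one_plus a iota i kappa j m : std_vac m ->
  std_vac (one_plus a (cl iota i) (cl kappa j) m).
Proof.
move=> vm z; rewrite ffunE; case: (vm z) => c ->; rewrite ffunE.
case: (vac_cl iota i (vac_cl kappa j vm) z) => c' ->.
by rewrite -mul_mpolyC -mpolyCM -mpolyCD; eexists.
Qed.

Definition tdiff i : mp -> mp := ddiff (troot F i) (tau_ i).

Lemma tdiff_linear i : linear (tdiff i).
Proof. exact: (ddiff_linear (troot_neq0 F2 i) (trootP F i)). Qed.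
HB.instance Definition _ i :=
  GRing.isLinear.Build F mp mp *:%R (tdiff i) (tdiff_linear i).

Definition pdiff (b : bool) i k (f : mp) : mp :=
  if i == k then 0 else ddiff (rroot F b i k) (refl b i k) f.

Lemma pdiff_linear b i k : linear (pdiff b i k).
Proof.
move=> c f g; rewrite /pdiff; case: eqVneq => [_|ik].
  by rewrite scaler0 addr0.
exact: (ddiff_linear (rroot_neq0 F b ik) (fun l => rrootP F b l ik)).
Qed.
HB.instance Definition _ b i k :=
  GRing.isLinear.Build F mp mp *:%R (pdiff b i k) (pdiff_linear b i k).

Lemma pw_tdiffX i j m :
  pw (tdiff i) (stdX j m) =
  stdX j (pw (tdiff i) m) + (j == i)%:R *: pw (weyl_act (tau_ i)) m.
Proof.
apply/ffunP => z; rewrite !ffunE.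
exact: (ddiffXM (troot_neq0 F2 i) (trootP F i)).
Qed.

Lemma pw_pdiffX b i k j m : i != k ->
  pw (pdiff b i k) (stdX j m) = stdX j (pw (pdiff b i k) m)
    + rcoef F b i k j *: pw (weyl_act (refl b i k)) m.
Proof.
move=> ik; apply/ffunP => z; rewrite !ffunE /pdiff (negPf ik).
exact: (ddiffXM (rroot_neq0 F b ik) (fun l => rrootP F b l ik)).
Qed.

Lemma vac_tdiff i m : std_vac m -> pw (tdiff i) m = 0.
Proof.
move=> vm; apply/ffunP => z; rewrite !ffunE; case: (vm z) => c ->.
exact: (ddiffC (troot_neq0 F2 i) (trootP F i)).
Qed.

Lemma vac_pdiff b i k m : std_vac m -> pw (pdiff b i k) m = 0.
Proof.
move=> vm; apply/ffunP => z; rewrite !ffunE; case: (vm z) => c ->.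
rewrite /pdiff; case: eqVneq => // ik.
exact: (ddiffC (rroot_neq0 F b ik) (fun l => rrootP F b l ik)).
Qed.

Theorem std_rep (G : {group {perm sletter n}}) t uu v : G \subset WB n ->
  (forall s, s \in G -> forall b k l, uu (b (+) ssgn s k (+) ssgn s l) = uu b) ->
  uu true = 0 \/ uu true = uu false -> v = 0 \/ uu true = uu false ->
  exists Y : 'I_n -> {linear M -> M},
    hcc_rep G t uu v (fun i => stdX i) Y (fun i => stdC i) (fun i => stdE i)
      (fun s => stdW s).
Proof.
move=> GB uus uuT vT.
pose act s : {linear M -> M} := pw (weyl_act s).
pose tD i : {linear M -> M} := pw (tdiff i).
pose rD b i k : {linear M -> M} := pw (pdiff b i k).
pose Y i : {linear M -> M} := dunkl t v uu (cl (@lshift n n)) (cl (@rshift n n)) shift tD rD i.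
exists Y; apply: (@standard_rep _ _ _ _ _ _ _ _ _ _ _ std_vac) => //.
- exact: std_cw.
- exact: std_xx.
- exact: std_wx.
- exact: std_ex.
- exact: std_cx.
- exact: std_vac_ind.
- by move=> i m vm; apply/vac_weyl/vac_cl.
- by move=> i m vm; apply/vac_cl.
- by move=> s m vm; apply/vac_weyl/vac_shift.
- move=> i m; apply: (@dunkl_vac _ _ _ _ _ _ _ _ _ _ _ std_vac).
  + by move=> j m'; apply: vac_cl.
  + by move=> j m'; apply: vac_cl.
  + by move=> s m'; apply: vac_shift.
  + by move=> b j k m' vm; apply/vac_one_plus/vac_shift.
  + by move=> j m'; apply: vac_tdiff.
  + by move=> b j k m'; apply: vac_pdiff.
- move=> i j m; apply: (@dunklX _ _ _ _ _ _ _ _ _ act) => //.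
  + by move=> i' j' m'; rewrite /= /stdX cl_pw.
  + by move=> i' j' m'; rewrite /= /stdX cl_pw.
  + by move=> s j' m'; rewrite /= /stdX shift_pw.
  + by move=> s i' m'; rewrite /= cl_pw.
  + by move=> s i' m'; rewrite /= cl_pw.
  + move=> s s' m' s'B; rewrite /= pw_pw; apply: eq_pw => f.
    by rewrite /= weyl_actM.
  + by move=> i' j' m'; apply: pw_tdiffX.
  + by move=> b i' k j' m' ik; apply: pw_pdiffX.
Qed.

End InducedModule.

(** * Modules over the free algebra and over H *)

Section FreeAlgebra.
Import finmap monalg.
Variables (F : fieldType) (T : weyl_type) (n : nat).
Local Notation A := (free_alg F T n).
Local Notation word := {fmonom gen T n}.
Local Notation fgen := (@fgen F T n).

Lemma free_alg_ind (Q : A -> Prop) :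
  Q 0 -> (forall f g, Q f -> Q g -> Q (f + g)) ->
  (forall c f, Q f -> Q (c *: f)) -> Q 1 -> (forall g f, Q f -> Q (fgen g * f)) ->
  forall f, Q f.
Proof.
move=> Q0 QD QZ Q1 QM f; rewrite [f]monalgE.
elim/big_rec: _ => // k h _ Qh; apply: QD => //.
have -> : mkmalgU k (mcoeff k f) = mcoeff k f *: (mkmalgU k 1 : A).
  by apply/malgP => k'; rewrite mcoeffZ !mcoeffU mulrnAr mulr1.
apply: QZ; case: k => w; elim: w => [|g w IH].
  suff -> : FMonom [::] = mone :> word by [].
  by apply/eqP; rewrite -val_eqE /= fm1.
suff -> : mkmalgU (FMonom (g :: w)) 1 = fgen g * (mkmalgU (FMonom w) 1 : A) by apply: QM.
apply: esym; apply: etrans (fgmulUU _ _ _ _) _; rewrite mulr1; congr mkmalgU.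
by apply/eqP; rewrite -val_eqE /= fmM fmU.
Qed.

Section Action.
Variables (M : lmodType F) (rho : gen T n -> {linear M -> M}).

Definition word_act (k : word) (m : M) : M := foldr (fun g => rho g) m (fmonom_val k).

Fact word_act_is_linear k : linear (word_act k).
Proof.
move=> c m m'; rewrite /word_act; elim: (fmonom_val k) => //= g w ->.
by rewrite linearP.
Qed.
HB.instance Definition _ k :=
  GRing.isLinear.Build F M M *:%R (word_act k) (word_act_is_linear k).

Definition free_act (f : A) (m : M) : M :=
  \sum_(k <- msupp f) mcoeff k f *: word_act k m.

Lemma free_actEw (d : {fset word}) f m :
  fsubset (msupp f) d -> free_act f m = \sum_(k <- d) mcoeff k f *: word_act k m.
Proof.
move=> le; rewrite [LHS](big_fset_incl _ le) => //= x xd /mcoeff_outdom ->.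
by rewrite scale0r.
Qed.

Fact free_act_is_linear f : linear (free_act f).
Proof.
move=> c m m'; rewrite /free_act scaler_sumr -big_split; apply: eq_bigr => k _ /=.
by rewrite linearP scalerDr !scalerA mulrC.
Qed.
HB.instance Definition _ f :=
  GRing.isLinear.Build F M M *:%R (free_act f) (free_act_is_linear f).

Lemma free_actP c f g m : free_act (c *: f + g) m = c *: free_act f m + free_act g m.
Proof.
pose d := fsetU (msupp (c *: f + g)) (fsetU (msupp f) (msupp g)).
rewrite !(@free_actEw d) ?fsubsetUl //.
- rewrite scaler_sumr -big_split; apply: eq_bigr => k _ /=.
  by rewrite mcoeffD mcoeffZ scalerDl scalerA.
- by apply: fsubset_trans (fsubsetUr _ _); apply: fsubsetUr.
- by apply: fsubset_trans (fsubsetUr _ _); apply: fsubsetUl.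
Qed.

Lemma free_act0 m : free_act 0 m = 0.
Proof. by rewrite /free_act msupp0 big_seq_fset0. Qed.

Lemma free_actU k c m : free_act (mkmalgU k c) m = c *: word_act k m.
Proof. by rewrite (free_actEw _ msuppU_le) big_seq_fset1 mcoeffUU. Qed.

Lemma free_act1 m : free_act 1 m = m.
Proof. by rewrite [free_act _ _]free_actU scale1r /word_act fm1. Qed.

Lemma free_act_gen g m : free_act (fgen g) m = rho g m.
Proof. by rewrite [LHS]free_actU scale1r /word_act fmU. Qed.

Lemma free_actD f g m : free_act (f + g) m = free_act f m + free_act g m.
Proof. by rewrite -[f]scale1r free_actP !scale1r. Qed.

Lemma free_actZ c f m : free_act (c *: f) m = c *: free_act f m.
Proof. by rewrite -[_ *: f]addr0 free_actP free_act0 addr0. Qed.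

Lemma free_actN f m : free_act (- f) m = - free_act f m.
Proof. by rewrite -[- f]scaleN1r free_actZ scaleN1r. Qed.

Lemma free_act_sum (I : Type) (r : seq I) (P : pred I) (f : I -> A) m :
  free_act (\sum_(i <- r | P i) f i) m = \sum_(i <- r | P i) free_act (f i) m.
Proof.
by elim/big_rec2: _ => [|i x y _ <-]; rewrite ?free_act0 ?free_actD.
Qed.

Lemma free_actM f g m : free_act (f * g) m = free_act f (free_act g m).
Proof.
rewrite malgME free_act_sum {2}/free_act; apply: eq_bigr => k1 _.
rewrite free_act_sum {2}/free_act linear_sum /= scaler_sumr; apply: eq_bigr => k2 _.
by rewrite free_actU linearZ /= scalerA /word_act fmM foldr_cat.
Qed.

Variable rel : A -> A -> Prop.
Hypothesis rel_act : forall l r, rel l r -> forall m, free_act l m = free_act r m.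

Lemma free_act_ideal f m : ideal_gen rel f -> free_act f m = 0.
Proof.
move=> If; elim: If m => [a b l r lr m|m|f1 f2 _ I1 _ I2 m].
- by rewrite !free_actM free_actD free_actN (rel_act lr) subrr linear0.
- exact: free_act0.
- by rewrite free_actD I1 I2 addr0.
Qed.

End Action.
End FreeAlgebra.

(** The three types differ only by the parameters of hcc_rep. *)
Section TypeParameters.
Variables (F : fieldType) (T : weyl_type).

Definition type_u (u : F) (b : bool) : F := if T is TypeA then (if b then 0 else u) else u.
Definition type_v (v : F) : F := if T is TypeB then v else 0.

Lemma type_yxE (V : lmodType F) u (a : bool -> V) :
  match T with TypeA => u *: a false | TypeD | TypeB => u *: a false - u *: a true end
  = \sum_(b : bool) ((-1) ^+ b * type_u u b) *: a b.
Proof.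
rewrite big_bool /= expr0 expr1 mul1r mulN1r addrC /type_u.
by case: T; rewrite ?oppr0 ?scale0r ?addr0 ?scaleNr.
Qed.

Lemma type_yx_diagE (V : lmodType F) u v (z w : V) (a : bool -> V) :
  match T with
  | TypeA => z - u *: a false
  | TypeD => z - u *: a false - u *: a true
  | TypeB => z - u *: a false - u *: a true - v *: w
  end = z - \sum_(b : bool) type_u u b *: a b - type_v v *: w.
Proof.
rewrite big_bool /= opprD (addrC (- _)) addrA /type_u /type_v.
by case: T; rewrite ?scale0r ?subr0 ?scale0r ?subr0.
Qed.
End TypeParameters.

Section HccRepresentations.
Variables (F : fieldType) (T : weyl_type) (n : nat) (t u v : F).
Local Notation H := (Hcc T n t u v).
Local Notation W := (weyl T n).
Local Notation A := (free_alg F T n).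

Local Notation type_u := (type_u T u).
Local Notation type_v := (type_v T v).

(** A conditional rather than a product with (-1) ^+ b, so that the terms of the
    presentation are instances of [free_crossing] by computation. *)
Definition signed (b : bool) (x : A) : A := if b then - x else x.
Definition free_crossing (b : bool) i j k l r : A :=
  (1 + signed b (fc F T i * fc F T j)) * (1 + signed b (fe F T k * fe F T l))
    * fwW F T r.

Lemma comm_yxE i j : comm_yx T u i j =
  \sum_(b : bool) ((-1) ^+ b * type_u b) *: free_crossing b i j j i (refl b i j).
Proof. by rewrite -type_yxE. Qed.

Lemma comm_yx_diagE i : comm_yx_diag T t u v i =
  t *: (fc F T i * fe F T i)
  - \sum_(b : bool) type_u b *: (\sum_(k < n | k != i) free_crossing b k i k i (refl b k i))
  - type_v *: fwW F T (tau_ i).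
Proof.
by rewrite -type_yx_diagE.
Qed.

Lemma type_uT : type_u true = 0 \/ type_u true = type_u false.
Proof. by rewrite /type_u; case: T; [left|right|right]. Qed.

Lemma type_vT : type_v = 0 \/ type_u true = type_u false.
Proof. by rewrite /type_u /type_v; case: T; [left|left|right]. Qed.

Lemma weyl_WB : W \subset WB n.
Proof. by apply/subsetP => s; case: T => //; rewrite inE => /andP[]. Qed.

Lemma type_u_weyl s : s \in W -> forall b k l,
  type_u (b (+) ssgn s k (+) ssgn s l) = type_u b.
Proof.
rewrite /type_u; case: T => // sA b k l.
have sg0 i : ssgn s i = false.
  by move: sA; rewrite inE => /andP[_ /forallP/(_ i)/negPf].
by rewrite !sg0 !addbF.
Qed.

Lemma refl_weyl b i j : i != j -> type_u b != 0 -> refl b i j \in W.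
Proof.
move=> ij; case: b => [|_]; last exact: s_weyl.
move=> uT; apply: sbar_weyl => // TA; move: uT.
by rewrite /type_u TA eqxx.
Qed.

Lemma tau_weylP i : type_v != 0 -> tau_ i \in W.
Proof. by rewrite /type_v; case: T; rewrite ?eqxx // => _; apply: tau_weyl. Qed.

Section ToAction.
Variables (M : lmodType F) (X Y C E : 'I_n -> {linear M -> M}).
Variable Wo : {perm sletter n} -> {linear M -> M}.

Definition gen_act (g : gen T n) : {linear M -> M} :=
  match g with
  | GX i => X i | GY i => Y i | GC i => C i | GE i => E i | GW s => Wo (sgval s)
  end.
Local Notation act := (free_act gen_act).

Lemma act_fx i m : act (fx F T i) m = X i m. Proof. exact: free_act_gen. Qed.
Lemma act_fy i m : act (fy F T i) m = Y i m. Proof. exact: free_act_gen. Qed.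
Lemma act_fc i m : act (fc F T i) m = C i m. Proof. exact: free_act_gen. Qed.
Lemma act_fe i m : act (fe F T i) m = E i m. Proof. exact: free_act_gen. Qed.
Lemma act_fws (s : subg_of W) m : act (fw F s) m = Wo (sgval s) m.
Proof. exact: free_act_gen. Qed.

(* The generators are kept folded: otherwise each failed match of a product
   against a generator unfolds the multiplication of the free algebra. *)
Opaque fx fy fc fe fw.
Lemma act_fw r m : r \in W -> act (fwW F T r) m = Wo r m.
Proof. by move=> rW; rewrite /fwW act_fws subgK. Qed.

Lemma act_signed b x m : act (1 + signed b x) m = m + (-1) ^+ b *: act x m.
Proof.
rewrite free_actD free_act1; congr (_ + _).
by case: b; rewrite /= ?scaleN1r ?scale1r // free_actN.
Qed.

Lemma act_free_crossing b i j k l r m : r \in W ->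
  act (free_crossing b i j k l r) m =
  one_plus ((-1) ^+ b) (C i) (C j) (one_plus ((-1) ^+ b) (E k) (E l) (Wo r m)).
Proof.
move=> rW.
have act2 x y m' : act (x * y) m' = act x (act y m') by apply: free_actM.
have act3 x y z m' : act (x * y * z) m' = act x (act y (act z m')) by rewrite !free_actM.
rewrite /free_crossing act3 act_fw //.
have actE m' : act (fe F T k * fe F T l) m' = E k (E l m').
  by rewrite act2 act_fe act_fe.
have actC m' : act (fc F T i * fc F T j) m' = C i (C j m').
  by rewrite act2 act_fc act_fc.
by rewrite (act_signed b (fc F T i * fc F T j)) actC
  (act_signed b (fe F T k * fe F T l)) actE.
Qed.

Lemma act_yx i j m : i != j -> act (comm_yx T u i j) m =
  \sum_(b : bool) ((-1) ^+ b * type_u b) *: crossing C E Wo b false i j m.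
Proof.
move=> ij; rewrite comm_yxE free_act_sum; apply: eq_bigr => b _; rewrite free_actZ.
have [->|ub] := eqVneq (type_u b) 0; first by rewrite mulr0 !scale0r.
by rewrite act_free_crossing ?refl_weyl // /crossing addbF.
Qed.

Lemma act_yxd i m : (forall k m', k != i -> C k (C i m') = - C i (C k m')) -> act (comm_yx_diag T t u v i) m =
  t *: C i (E i m)
  - \sum_(b : bool) type_u b *: (\sum_(k | k != i) crossing C E Wo b true i k m)
  - type_v *: Wo (tau_ i) m.
Proof.
move=> cc; rewrite comm_yx_diagE (free_actD _ (_ - _)) (free_actD _ (_ *: _)) !free_actN.
congr (_ - _ - _).
  by rewrite free_actZ free_actM act_fc act_fe.
  rewrite free_act_sum; apply: eq_bigr => b _; rewrite free_actZ.
  have [->|ub] := eqVneq (type_u b) 0; first by rewrite !scale0r.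
  congr (_ *: _); rewrite free_act_sum; apply: eq_bigr => k ki.
  rewrite act_free_crossing ?refl_weyl // /crossing addbT reflC.
  by rewrite /one_plus (cc _ _ ki) scalerN -scaleNr signrN.
rewrite free_actZ; have [->|v0] := eqVneq type_v 0; first by rewrite !scale0r.
by rewrite act_fw ?tau_weylP.
Qed.

Lemma act_sact s (a : 'I_n -> A) i w m :
  act (sact s a i * w) m = (-1) ^+ ssgn s i *: act (a (spos s i)) (act w m).
Proof. by rewrite (sactE (V := A)) free_actM free_actZ. Qed.

Lemma act_fyx i j m' : act (fy F T i * fx F T j) m' = Y i (X j m').
Proof. by rewrite free_actM act_fy act_fx. Qed.

Lemma act_fxy i j m' : act (fx F T j * fy F T i) m' = X j (Y i m').
Proof. by rewrite free_actM act_fx act_fy. Qed.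

Lemma act_bracket i j m' : act (fy F T i * fx F T j - fx F T j * fy F T i) m' =
    Y i (X j m') - X j (Y i m').
Proof. by rewrite -act_fyx -act_fxy -free_actN -free_actD. Qed.

Lemma act_sign b x m : act ((-1) ^+ (b : bool) * x) m = (-1) ^+ b *: act x m.
Proof. by case: b; rewrite ?mulN1r ?mul1r ?free_actN ?scaleN1r ?scale1r. Qed.

Definition hcc_ops_rep := hcc_rep W t (type_u : bool -> F) type_v X Y C E Wo.

Lemma act_rel : hcc_ops_rep -> forall l r, Hcc_rel t u v l r -> forall m, act l m = act r m.
Proof.
case=> cw xx yy wx wy ex cx cy ey yx yxd l r.
case=> [|s1 s2|i|i|i j ij|i j ij|i j|i j|i j|s i|s i|s i|s i|i j|i j|i j|i j|i j ij|i] m.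
- by rewrite act_fws free_act1 (rep_w1 cw).
- by rewrite free_actM 3!act_fws (rep_wM cw) ?subgP.
- by rewrite free_actM 2!act_fc free_act1 (rep_c2 cw).
- by rewrite free_actM 2!act_fe free_act1 (rep_e2 cw).
- by rewrite free_actN [LHS]free_actM (free_actM _ (fc F T j)) 4!act_fc (rep_cc cw).
- by rewrite free_actN [LHS]free_actM (free_actM _ (fe F T j)) 4!act_fe (rep_ee cw).
- by rewrite free_actN [LHS]free_actM (free_actM _ (fe F T j)) 2!act_fe 2!act_fc (rep_ce cw).
- by rewrite [LHS]free_actM [RHS]free_actM 4!act_fx xx.
- by rewrite [LHS]free_actM [RHS]free_actM 4!act_fy yy.
- by rewrite [RHS]act_sact [LHS]free_actM 2!act_fx 2!act_fws wx ?subgP.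
- by rewrite [RHS]act_sact [LHS]free_actM 2!act_fy 2!act_fws wy ?subgP.
- by rewrite [RHS]act_sact [LHS]free_actM 2!act_fc 2!act_fws (rep_wc cw) ?subgP.
- by rewrite [RHS]act_sact [LHS]free_actM 2!act_fe 2!act_fws (rep_we cw) ?subgP.
- by rewrite [LHS]free_actM [RHS]free_actM 2!act_fe 2!act_fx ex.
- by rewrite [RHS]act_sign [LHS]free_actM (free_actM _ (fx F T j)) 2!act_fc 2!act_fx cx.
- by rewrite [LHS]free_actM [RHS]free_actM 2!act_fc 2!act_fy cy.
- by rewrite [RHS]act_sign [LHS]free_actM (free_actM _ (fy F T j)) 2!act_fe 2!act_fy ey.
- apply: etrans (act_bracket i j m) _; rewrite act_yx // yx //.
  by rewrite addrC addKr.
- apply: etrans (act_bracket i i m) _; rewrite (act_yxd _ (fun k m' => @rep_cc _ _ _ _ _ _ _ cw k i m')) yxd.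
  by rewrite addrC -!addrA addKr.
Qed.

Lemma act_Hpi f g : hcc_ops_rep -> Hpi t u v f = Hpi t u v g -> forall m, act f m = act g m.
Proof.
move=> rep /quot_piP fg m; apply/eqP; rewrite -subr_eq0 -free_actN -free_actD.
by rewrite (free_act_ideal (act_rel rep)).
Qed.

(** Applied to the action of H on itself, this turns statements about operators
    into identities between elements of H. *)
Lemma rep_of_rel :
  (forall l r, Hcc_rel t u v l r -> forall m, act l m = act r m) -> hcc_ops_rep.
Proof.
move=> R.
have cc i j m : i != j -> C i (C j m) = - C j (C i m).
  move=> ij; have := R _ _ (rel_cc T t u v ij) m.
  by rewrite free_actN [LHS]free_actM (free_actM _ (fc F T j)) 4!act_fc.
split=> [|i j m|i j m|s i m sW|s i m sW|i j m|i j m|i j m|i j m|i j m ij|i m].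
- split=> [m|s1 s2 m s1W s2W|i m|i m||i j m ij|i j m|s i m sW|s i m sW].
  + by have := R _ _ (rel_w1 T n t u v) m; rewrite act_fws free_act1.
  + have := R _ _ (rel_wM t u v (subg W s1) (subg W s2)) m.
    by rewrite free_actM 3!act_fws /= !subgK ?groupM.
  + by have := R _ _ (rel_c2 T t u v i) m; rewrite free_actM 2!act_fc free_act1.
  + by have := R _ _ (rel_e2 T t u v i) m; rewrite free_actM 2!act_fe free_act1.
  + exact: cc.
  + have := R _ _ (rel_ee T t u v ij) m.
    by rewrite free_actN [LHS]free_actM (free_actM _ (fe F T j)) 4!act_fe.
  + have := R _ _ (rel_ce T t u v i j) m.
    by rewrite free_actN [LHS]free_actM (free_actM _ (fe F T j)) 2!act_fe 2!act_fc.
  + have := R _ _ (rel_wc t u v (subg W s) i) m.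
    by rewrite [RHS]act_sact [LHS]free_actM 2!act_fc 2!act_fws subgK.
  + have := R _ _ (rel_we t u v (subg W s) i) m.
    by rewrite [RHS]act_sact [LHS]free_actM 2!act_fe 2!act_fws subgK.
- by have := R _ _ (rel_xx T t u v i j) m; rewrite [LHS]free_actM [RHS]free_actM 4!act_fx.
- by have := R _ _ (rel_yy T t u v i j) m; rewrite [LHS]free_actM [RHS]free_actM 4!act_fy.
- have := R _ _ (rel_wx t u v (subg W s) i) m.
  by rewrite [RHS]act_sact [LHS]free_actM 2!act_fx 2!act_fws subgK.
- have := R _ _ (rel_wy t u v (subg W s) i) m.
  by rewrite [RHS]act_sact [LHS]free_actM 2!act_fy 2!act_fws subgK.
- have := R _ _ (rel_ex T t u v i j) m.
  by rewrite [LHS]free_actM [RHS]free_actM 2!act_fe 2!act_fx.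
- have := R _ _ (rel_cx T t u v i j) m.
  by rewrite [RHS]act_sign [LHS]free_actM (free_actM _ (fx F T j)) 2!act_fc 2!act_fx.
- have := R _ _ (rel_cy T t u v i j) m.
  by rewrite [LHS]free_actM [RHS]free_actM 2!act_fc 2!act_fy.
- have := R _ _ (rel_ey T t u v i j) m.
  by rewrite [RHS]act_sign [LHS]free_actM (free_actM _ (fy F T j)) 2!act_fe 2!act_fy.
- have e := act_yx m ij.
  have e' := etrans (esym (act_bracket i j m)) (etrans (R _ _ (rel_yx T t u v ij) m) e).
  by rewrite (canRL (subrK _) e') addrC.
- have e := act_yxd m (fun k m' => cc k i m').
  have e' := etrans (esym (act_bracket i i m)) (etrans (R _ _ (rel_yx_diag T t u v i) m) e).
  by rewrite (canRL (subrK _) e') addrC !addrA.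
Qed.

End ToAction.
End HccRepresentations.

(** * H as a module over itself; polynomials in x and in y *)

Transparent fx fy fc fe fw.

Section HccFacts.
Variables (F : fieldType) (T : weyl_type) (n : nat) (t u v : F).
Local Notation H := (Hcc T n t u v).
Local Notation W := (weyl T n).
Local Notation A := (free_alg F T n).
Local Notation pi := (@Hpi F T n t u v).

Lemma Hpi_surj (h : H) : exists f, h = pi f.
Proof. by exists (quot_repr h); rewrite [RHS]quot_reprK. Qed.

Lemma HpiD f g : pi (f + g) = pi f + pi g. Proof. exact: raddfD. Qed.
Lemma Hpi0 : pi 0 = 0. Proof. exact: raddf0. Qed.
Lemma Hpi1 : pi 1 = 1. Proof. exact: rmorph1. Qed.
Lemma HpiM f g : pi (f * g) = pi f * pi g. Proof. exact: rmorphM. Qed.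
Lemma HpiZ c f : pi (c *: f) = c *: pi f. Proof. exact: quot_piZ. Qed.
Lemma Hpi_rel l r : Hcc_rel t u v l r -> pi l = pi r. Proof. exact: quot_pi_rel. Qed.

Definition lmulH (h : H) (m : H) : H := h * m.
Fact lmulH_is_linear h : linear (lmulH h).
Proof. by move=> c m m'; rewrite /lmulH mulrDr Hcc_scalerAr. Qed.
HB.instance Definition _ h :=
  GRing.isLinear.Build F H H *:%R (lmulH h) (lmulH_is_linear h).

Definition hgen (g : gen T n) : {linear H -> H} := lmulH (pi (fgen F g)).
Definition hx i := hgen (GX T i).
Definition hy i := hgen (GY T i).
Definition hc i := hgen (GC T i).
Definition he i := hgen (GE T i).
Definition hw s := hgen (GW (subg W s)).

Lemma hgenE g m : pi (fgen F g) * m = hgen g m. Proof. by []. Qed.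

Lemma gen_act_hgen g m : gen_act hx hy hc he hw g m = hgen g m.
Proof. by case: g => [i|i|i|i|s]; rewrite /= ?/hw ?sgvalK. Qed.

Lemma regular_act f m : free_act (gen_act hx hy hc he hw) f m = pi f * m.
Proof.
elim/free_alg_ind: f m => [|f g IHf IHg|c f IH||g f IH] m.
- by rewrite free_act0 Hpi0 mul0r.
- by rewrite free_actD IHf IHg HpiD mulrDl.
- by rewrite free_actZ IH HpiZ Hcc_scalerAl.
- by rewrite free_act1 Hpi1 mul1r.
- by rewrite free_actM IH HpiM -mulrA free_act_gen gen_act_hgen hgenE.
Qed.

Lemma regular_rep : hcc_ops_rep T t u v hx hy hc he hw.
Proof. by apply: rep_of_rel => l r lr m; rewrite !regular_act (Hpi_rel lr). Qed.

Lemma Hcc_ind (Q : H -> Prop) :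
  Q 0 -> (forall f g, Q f -> Q g -> Q (f + g)) ->
  (forall c f, Q f -> Q (c *: f)) -> Q 1 ->
  (forall i m, Q m -> Q (hx i m)) -> (forall i m, Q m -> Q (hy i m)) ->
  (forall i m, Q m -> Q (hc i m)) -> (forall i m, Q m -> Q (he i m)) ->
  (forall s m, s \in W -> Q m -> Q (hw s m)) -> forall h, Q h.
Proof.
move=> Q0 QD QZ Q1 Qx Qy Qc Qe Qw h; have [f ->] := Hpi_surj h.
elim/free_alg_ind: f => [|f g IHf IHg|c f IH||g f IH].
- by rewrite Hpi0.
- by rewrite HpiD; apply: QD.
- by rewrite HpiZ; apply: QZ.
- by rewrite Hpi1.
- rewrite HpiM hgenE -gen_act_hgen; case: g => [i|i|i|i|s].
  + exact: Qx.
  + exact: Qy.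
  + exact: Qc.
  + exact: Qe.
  + exact: Qw (subgP s) IH.
Qed.

Definition free_eval (a : 'I_n -> A) (p : {mpoly F[n]}) : A :=
  \sum_(m <- mpoly.msupp p) p@_m *: \prod_(i < n) a i ^+ m i.

Lemma Hpi_eval a p : pi (free_eval a p) = Heval (fun i => pi (a i)) p.
Proof.
rewrite /free_eval /Heval [LHS]raddf_sum; apply: eq_bigr => m _.
rewrite [LHS]HpiZ; congr (_ *: _); rewrite [LHS]rmorph_prod; apply: eq_bigr => i _.
exact: rmorphXn.
Qed.

Hypothesis F2 : 2%:R != 0 :> F.
Local Notation M := (std_mod F n).

(** Multiplication by a polynomial on the standard module determines the polynomial;
    this is what keeps the values of different polynomials in x apart in H. *)
Lemma act_free_eval (rho : gen T n -> {linear M -> M}) (a : 'I_n -> A) p (m : M) :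
  (forall i m, free_act rho (a i) m = stdX i m) ->
  free_act rho (free_eval a p) m = [ffun z => p * m z].
Proof.
move=> aX; rewrite /free_eval free_act_sum; apply/ffunP => z.
rewrite sum_ffunE ffunE {3}(mpolyE p) mulr_suml; apply: eq_bigr => k _.
rewrite free_actZ ffunE -scalerAl; congr (_ *: _).
pose R (x : A) (g : {mpoly F[n]}) := forall m z, free_act rho x m z = g * m z.
have R1 : R 1 1 by move=> m' z'; rewrite free_act1 mul1r.
have RM x x' g g' : R x g -> R x' g' -> R (x * x') (g * g').
  by move=> Rx Rx' m' z'; rewrite free_actM Rx Rx' mulrA.
suff : R (\prod_(i < n) a i ^+ k i) 'X_[k] by apply.
rewrite mpolyXE_id; elim/big_rec2: _ => // i g x _; apply: (RM).
elim: (k i) => [|l IH]; first by rewrite !expr0.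
by rewrite !exprS; apply: RM => // m' z'; rewrite aX ffunE.
Qed.

Lemma eval_inj_gen (rho : gen T n -> {linear M -> M}) (a : 'I_n -> A) :
  (forall i m, free_act rho (a i) m = stdX i m) ->
  (forall f g, pi f = pi g -> forall m, free_act rho f m = free_act rho g m) ->
  forall p q, Heval (fun i => pi (a i)) p = Heval (fun i => pi (a i)) q -> p = q.
Proof.
move=> aX wd p q; rewrite -!Hpi_eval => /wd/(_ [ffun=> 1]).
rewrite (act_free_eval p _ aX) (act_free_eval q _ aX) => /ffunP/(_ (1%g, [ffun=> false])).
by rewrite !ffunE !mulr1.
Qed.

Lemma std_rep_X : exists Y, hcc_ops_rep (M := M) T t u v
  (fun i => stdX i) Y (fun i => stdC i) (fun i => stdE i) (fun s => stdW s).
Proof.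
have [Y rep] := std_rep F2 t (weyl_WB T n) (type_u_weyl (T := T) (n := n) u)
  (type_uT T u) (type_vT T u v).
by exists Y.
Qed.

(** The parameters are changed beforehand, so that after exchanging x and y the
    original ones come out. *)
Lemma std_rep_Y : exists X, hcc_ops_rep (M := M) T t u v
  X (fun i => stdX i) (fun i => stdE i) (fun i => stdC i) (fun s => stdW s).
Proof.
have oppK : (fun b => - - type_u T u b) = type_u T u by apply/funext => b; rewrite opprK.
have uT : - type_u T u true = 0 \/ - type_u T u true = - type_u T u false.
  by case: (type_uT T u) => ->; [left; rewrite oppr0|right].
have vT : - type_v T v = 0 \/ - type_u T u true = - type_u T u false.
  by case: (type_vT T u v) => ->; [left; rewrite oppr0|right].
have [s sW b k l|Y rep] := std_rep F2 (uu := fun b => - type_u T u b) t (weyl_WB T n) _ uT vT.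
  by rewrite (type_u_weyl (T := T)).
exists Y; have := hcc_rep_swap rep.
by rewrite oppK opprK.
Qed.

Lemma Heval_x_inj p q : Heval (@Hx F T n t u v) p = Heval (@Hx F T n t u v) q -> p = q.
Proof.
have [Y rep] := std_rep_X.
apply: (@eval_inj_gen (gen_act (fun i => stdX i) Y (fun i => stdC i) (fun i => stdE i) (fun s => stdW s))).
  by move=> i m; rewrite act_fx.
by move=> f g fg m; apply: (act_Hpi rep fg).
Qed.

Lemma Heval_y_inj p q : Heval (@Hy F T n t u v) p = Heval (@Hy F T n t u v) q -> p = q.
Proof.
have [X rep] := std_rep_Y.
apply: (@eval_inj_gen (gen_act X (fun i => stdX i) (fun i => stdE i) (fun i => stdC i) (fun s => stdW s))).
  by move=> i m; rewrite act_fy.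
by move=> f g fg m; apply: (act_Hpi rep fg).
Qed.

Lemma Hcc_neq0 : (1 : H) != 0.
Proof.
have [Y rep] := std_rep_X.
apply/eqP; rewrite -Hpi1 -Hpi0 => /(act_Hpi rep)/(_ [ffun=> 1]).
rewrite free_act1 free_act0 => /ffunP/(_ (1%g, [ffun=> false])).
by rewrite !ffunE => /eqP; rewrite oner_eq0.
Qed.

End HccFacts.

Section Evenness.
Import monalg.
Variables (F : fieldType) (T : weyl_type) (n : nat) (t u v : F).
Local Notation H := (Hcc T n t u v).
Local Notation pi := (@Hpi F T n t u v).
Local Notation even := (@Hcc_even F T n t u v).

Lemma even_add h h' : even h -> even h' -> even (h + h').
Proof.
move=> [f ef ->] [g eg ->]; exists (f + g); last by rewrite HpiD.
by move=> m om; rewrite mcoeffD ef // eg // addr0.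
Qed.

Lemma even_scale c h : even h -> even (c *: h).
Proof.
move=> [f ef ->]; exists (c *: f); last by rewrite HpiZ.
by move=> m om; rewrite mcoeffZ ef // mulr0.
Qed.

Lemma even_mul h h' : even h -> even h' -> even (h * h').
Proof.
move=> [f ef ->] [g eg ->]; exists (f * g); last by rewrite HpiM.
move=> m om; rewrite mcoeffMl big1 // => k1 _; rewrite big1 // => k2 _.
case: eqP => [km|_]; rewrite ?mulr0n //.
have : word_odd k1 (+) word_odd k2.
  by rewrite -oddD -count_cat -fmM km.
case o1: (word_odd k1) => /= o2; first by rewrite ef // mul0r.
by rewrite (eg k2) // mulr0.
Qed.

Lemma even1 : even 1.
Proof.
exists 1; last by rewrite Hpi1.
move=> m; rewrite mcoeff1; case: eqP => // ->.
by rewrite /word_odd fm1.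
Qed.

Lemma even_gen g : ~~ gen_odd g -> even (pi (fgen F g)).
Proof.
move=> eg; exists (fgen F g) => // m om.
rewrite mcoeffU1; case: eqP om => // <-.
by rewrite /word_odd fmU /= (negPf eg).
Qed.

End Evenness.

(** * Evaluation at commuting elements *)

Section Evaluation.
Variables (F : fieldType) (n : nat) (A : algType F).
Local Notation mp := {mpoly F[n]}.

Definition eval_at (a : 'I_n -> A) (p : mp) : A :=
  \sum_(m <- msupp p) p@_m *: \prod_(i < n) a i ^+ m i.

Lemma eval_atE a p : eval_at a p = mmap (in_alg A) a p.
Proof. by apply: eq_bigr => m _; rewrite /= mulr_algl. Qed.

Section Commuting.
Variable a : 'I_n -> A.
Hypothesis aC : forall i j, a i * a j = a j * a i.

Lemma eval_atD p q : eval_at a (p + q) = eval_at a p + eval_at a q.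
Proof. by rewrite !eval_atE mmapD. Qed.

Lemma eval_atZ c p : eval_at a (c *: p) = c *: eval_at a p.
Proof. by rewrite !eval_atE mmapZ /= mulr_algl. Qed.

Lemma prod_comm_split (I : eqType) (r : seq I) (f g : I -> A) :
  (forall i j, f i * g j = g j * f i) ->
  \prod_(i <- r) (f i * g i) = \prod_(i <- r) f i * \prod_(i <- r) g i.
Proof.
move=> fg; elim: r => [|i r IH]; first by rewrite !big_nil mulr1.
rewrite !big_cons IH -!mulrA; congr (_ * _); rewrite !mulrA; congr (_ * _).
by apply: commr_prod => j _; apply/esym/fg.
Qed.

Lemma eval_atMX p m : eval_at a (p * 'X_[m]) = eval_at a p * eval_at a 'X_[m].
Proof.
elim/mpolyind: p => [|c k p _ _ IH]; first by rewrite mul0r !eval_atE mmap0 mul0r.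
rewrite mulrDl !eval_atD IH mulrDl; congr (_ + _).
rewrite -scalerAl !eval_atZ -scalerAl; congr (_ *: _).
rewrite -mpolyXD !eval_atE !mmapX /mmap1 -prod_comm_split => [|i j].
  by apply: eq_bigr => i _; rewrite mnmDE exprD.
by apply: commrX; apply/commr_sym/commrX; apply/commr_sym/aC.
Qed.

Lemma eval_atM p q : eval_at a (p * q) = eval_at a p * eval_at a q.
Proof.
elim/mpolyind: q => [|c m q _ _ IH]; first by rewrite mulr0 !eval_atE mmap0 mulr0.
by rewrite mulrDr !eval_atD -scalerAr !eval_atZ eval_atMX IH mulrDr scalerAr.
Qed.

Lemma eval_atC c : eval_at a c%:MP = c *: 1.
Proof. by rewrite eval_atE mmapC. Qed.

Lemma eval_at0 : eval_at a 0 = 0.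
Proof. by rewrite -mpolyC0 eval_atC scale0r. Qed.

Lemma eval_at1 : eval_at a 1 = 1.
Proof. by rewrite -mpolyC1 eval_atC scale1r. Qed.

Lemma eval_atX i : eval_at a 'X_i = a i.
Proof. by rewrite eval_atE mmapX mmap1U. Qed.

End Commuting.

Lemma eval_at_comp (a b : 'I_n -> A) (lq : n.-tuple mp) p :
  (forall i j, a i * a j = a j * a i) ->
  (forall i, b i = eval_at a (tnth lq i)) -> eval_at b p = eval_at a (p \mPo lq).
Proof.
move=> aC bE; have bC i j : b i * b j = b j * b i by rewrite !bE -!eval_atM // mulrC.
elim/mpoly_XU_ind: p => [c|p q IHp IHq|i p IH].
- by rewrite comp_mpolyC !eval_atC.
- by rewrite comp_mpolyD !eval_atD IHp IHq.
- by rewrite rmorphM /= comp_mpolyXU -tnth_nth !eval_atM // IH -bE eval_atX.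
Qed.

Lemma eval_at_twist (a b : 'I_n -> A) w p :
  (forall i j, a i * a j = a j * a i) -> (forall i j, b i * b j = b j * b i) ->
  (forall i, w * a i = b i * w) -> w * eval_at a p = eval_at b p * w.
Proof.
move=> aC bC wab; elim/mpoly_XU_ind: p => [c|p q IHp IHq|i p IH].
- by rewrite !eval_atC -scalerAl mul1r -scalerAr mulr1.
- by rewrite !eval_atD mulrDr mulrDl IHp IHq.
- by rewrite !eval_atM // !eval_atX mulrA wab -mulrA IH mulrA.
Qed.

Lemma eval_at_comm (a : 'I_n -> A) w p : (forall i j, a i * a j = a j * a i) ->
  (forall i, w * a i = a i * w) -> w * eval_at a p = eval_at a p * w.
Proof. by move=> aC wa; apply: eval_at_twist. Qed.

Section Bracket.
(** The elements X, y and D stand for the squares x_k^2, for y_i and for the A_j. *)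
Variables (X : 'I_n -> A) (y : A) (i : 'I_n) (D : 'I_n -> A).
Hypothesis XC : forall j k, X j * X k = X k * X j.
Hypothesis yX : forall j, j != i -> y * X j = X j * y + D j.
Hypothesis yXi : y * X i = X i * y - \sum_(j < n | j != i) D j.
Hypothesis DX : forall j k, j != i -> D j * X k = X (tperm i j k) * D j.

Let Del j : mp -> mp := ddiff (rroot F false i j) (refl false i j).

Let D_eval j p : j != i -> D j * eval_at X p = eval_at X (weyl_act (refl false i j) p) * D j.
Proof.
move=> ji; rewrite (eval_at_twist (b := fun k => X (tperm i j k))) //.
  congr (_ * _); rewrite /weyl_act; apply: eval_at_comp => // k.
  rewrite tnth_mktuple (sactE _ (fun k => 'X_k : mp)) ssgn_refl spos_refl.
  by rewrite scale1r eval_atX.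
by move=> k; apply: DX.
Qed.

Lemma bracket_eval p : y * eval_at X p = eval_at X p * y
  - \sum_(j < n | j != i) eval_at X (Del j p) * D j.
Proof.
have Delta j (ji : j != i) : i != j by rewrite eq_sym.
elim/mpoly_XU_ind: p => [c|p q IHp IHq|k p IH].
- rewrite big1 ?subr0 => [|j ji]; last first.
    rewrite /Del (ddiffC (rroot_neq0 F false (Delta _ ji)) (fun l => rrootP F false l (Delta _ ji))).
    by rewrite eval_at0 mul0r.
  by rewrite !eval_atC -scalerAl mul1r -scalerAr mulr1.
- rewrite !eval_atD mulrDr mulrDl IHp IHq addrACA -opprD -big_split.
  congr (_ - _); apply: eq_bigr => j ji /=.
  rewrite -mulrDl -eval_atD; congr (eval_at X _ * _).
  by rewrite /Del (ddiffD (rroot_neq0 F false (Delta _ ji)) (fun l => rrootP F false l (Delta _ ji))).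
- have DelXM j : j != i -> eval_at X (Del j ('X_k * p)) * D j =
      X k * (eval_at X (Del j p) * D j) + rcoef F false i j k *: (D j * eval_at X p).
    move=> ji; rewrite /Del (ddiffXM (rroot_neq0 F false (Delta _ ji)) (fun l => rrootP F false l (Delta _ ji))).
    by rewrite eval_atD eval_atZ eval_atM // eval_atX mulrDl -mulrA -scalerAl D_eval.
  rewrite (eq_bigr _ DelXM) big_split /= -mulr_sumr opprD addrA.
  rewrite eval_atM // eval_atX -[X k * _ * y]mulrA -mulrBr -IH !mulrA.
  have [->|ki] := eqVneq k i.
    rewrite yXi mulrBl; congr (_ - _); rewrite mulr_suml; apply: eq_bigr => j ji.
    by rewrite /rcoef eqxx eq_sym (negPf ji) mulr0 subr0 scale1r.
  rewrite yX // mulrDl; congr (_ + _); rewrite (bigD1 k) //= big1 ?addr0 => [|j /andP[ji jk]].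
    by rewrite /rcoef eqxx (negPf ki) expr0 mul1r sub0r scaleN1r opprK.
  by rewrite /rcoef (negPf ki) eq_sym (negPf jk) mulr0 subr0 scale0r.
Qed.

Lemma bracket_symmetric p :
  (forall j, weyl_act (refl false i j) p = p) -> y * eval_at X p = eval_at X p * y.
Proof.
move=> sp; rewrite bracket_eval big1 ?subr0 // => j ji.
have ij : i != j by rewrite eq_sym.
rewrite /Del (ddiff_eq (rroot_neq0 F false ij) (fun l => rrootP F false l ij) (g := 0)) ?eval_at0 ?mul0r //.
by rewrite mulr0 sp subrr.
Qed.

End Bracket.
End Evaluation.

(** * Centrality of symmetric polynomials in the squares *)

Section SquareBracket.
Variables (F : fieldType) (n : nat) (M : lmodType F).
Local Notation op := {linear M -> M}.
Implicit Types (m : M) (i j k : 'I_n) (b d : bool).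
Variables (G : {group {perm sletter n}}) (t v : F) (uu : bool -> F).
Variables (X Y C E : 'I_n -> op) (Wo : {perm sletter n} -> op).
Hypothesis rep : hcc_rep G t uu v X Y C E Wo.
Hypothesis reflG : forall b i j, i != j -> uu b != 0 -> refl b i j \in G.
Hypothesis tauG : forall i, v != 0 -> tau_ i \in G.
Local Notation P := (crossing C E Wo).

Lemma ee_X c i j k m :
  one_plus c (E i) (E j) (X k m) = X k (one_plus c (E i) (E j) m).
Proof. by rewrite /one_plus !(rep_ex rep) linearD linearZ. Qed.

Lemma cc_X c i j k m : i != j -> one_plus c (C i) (C j) (X k m) =
  X k (one_plus (if (k == i) || (k == j) then - c else c) (C i) (C j) m).
Proof.
have ccX : C i (C j (X k m)) = (-1) ^+ ((i == k) (+) (j == k)) *: X k (C i (C j m)).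
  by rewrite (rep_cx rep) [C i (_ *: _)]linearZ /= (rep_cx rep) scalerA -signr_addb addbC.
move=> ij; rewrite /one_plus ccX linearD [X k (_ *: _)]linearZ [k == i]eq_sym [k == j]eq_sym /=.
have [ik|_] := eqVneq i k; have [jk|_] := eqVneq j k => //=.
- by rewrite ik jk eqxx in ij.
- by rewrite expr1 scaleN1r scalerN scaleNr.
- by rewrite expr1 scaleN1r scalerN scaleNr.
- by rewrite expr0 scale1r.
Qed.

Lemma crossing_X b d i j k m : i != j -> refl b i j \in G ->
  P b d i j (X k m) =
  (-1) ^+ (b && ((k == i) || (k == j))) *: X (tperm i j k)
     (P b (d (+) ((k == i) || (k == j))) i j m).
Proof.
move=> ij rG; rewrite /crossing (rep_wx rep) // spos_refl ssgn_refl.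
rewrite [one_plus _ (E j) _ _]linearZ [one_plus _ (C i) _ _]linearZ /= ee_X cc_X //.
congr (_ *: X _ (one_plus _ _ _ _)).
have -> : (tperm i j k == i) || (tperm i j k == j) = (k == i) || (k == j).
  by case: tpermP => [->|->|]; rewrite ?eqxx ?orbT.
by case: (_ || _); rewrite ?addbF // addbT addbN signrN.
Qed.

Definition square_cross b i j m : M := P b false i j (X j m) + X j (P b false i j m).

Fact square_cross_is_linear b i j : linear (square_cross b i j).
Proof.
move=> c m m'; rewrite /square_cross (linearP (X j)) !crossing_is_linear.
by rewrite (linearP (X j)) addrACA -scalerDr.
Qed.
HB.instance Definition _ b i j :=
  GRing.isLinear.Build F M M *:%R (square_cross b i j) (square_cross_is_linear b i j).

Lemma square_crossX b i j k m : i != j -> refl b i j \in G ->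
  square_cross b i j (X k (X k m)) =
  X (tperm i j k) (X (tperm i j k) (square_cross b i j m)).
Proof.
move=> ij rG.
have PXX d m' : P b d i j (X k (X k m')) =
    X (tperm i j k) (X (tperm i j k) (P b d i j m')).
  rewrite !crossing_X // linearZ /= scalerA -signr_addb addbb scale1r.
  by rewrite -addbA addbb addbF.
rewrite /square_cross; set k' := tperm i j k.
rewrite (rep_xx rep j k) (rep_xx rep j k) PXX PXX -/k'.
by rewrite (rep_xx rep j k') (rep_xx rep j k') !linearD.
Qed.

(** Moving x_i through a crossing turns it into x_k and exchanges d = true and
    d = false, so that the terms of [y_i, x_i^2] are those of [y_i, x_k^2], up to
    the sign. *)
Lemma square_cross_diag b i k m : i != k -> refl b i k \in G ->
  P b true i k (X i m) + X i (P b true i k m) = (-1) ^+ b *: square_cross b i k m.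
Proof.
move=> ik rG; rewrite /square_cross !crossing_X // !eqxx ?orbT andbT tpermL tpermR.
by rewrite scalerDr scalerA -signr_addb addbb scale1r addrC.
Qed.

Definition sq_bracket i j m : M :=
  \sum_(b : bool) ((-1) ^+ b * uu b) *: square_cross b i j m.

Lemma sq_bracket_offdiag i j m : i != j ->
  Y i (X j (X j m)) = X j (X j (Y i m)) + sq_bracket i j m.
Proof.
move=> ij; rewrite !(rep_yx rep) // linearD /= -addrA; congr (_ + _).
rewrite (linear_sum (X j)) -big_split; apply: eq_bigr => b _ /=.
by rewrite linearZ -scalerDr addrC.
Qed.

(** The terms in t and v disappear: x_i anticommutes with c_i e_i and with
    tau_i. *)
Lemma sq_bracket_diag i m :
  Y i (X i (X i m)) = X i (X i (Y i m)) - \sum_(j < n | j != i) sq_bracket i j m.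
Proof.
have tX : C i (E i (X i m)) = - X i (C i (E i m)).
  by rewrite (rep_ex rep) (rep_cx rep) eqxx scaleN1r.
have vX : v *: Wo (tau_ i) (X i m) = - (v *: X i (Wo (tau_ i) m)).
  have [->|v0] := eqVneq v 0; first by rewrite !scale0r oppr0.
  by rewrite (rep_wx rep) ?tauG // spos_tau ssgn_tau eqxx scaleN1r scalerN.
have uX b : uu b *: (\sum_(k | k != i) P b true i k (X i m))
    + X i (uu b *: (\sum_(k | k != i) P b true i k m))
    = \sum_(k | k != i) ((-1) ^+ b * uu b) *: square_cross b i k m.
  rewrite [X i (_ *: _)]linearZ /= (linear_sum (X i)) -scalerDr -big_split scaler_sumr.
  apply: eq_bigr => k ki /=; have [->|ub] := eqVneq (uu b) 0.
    by rewrite mulr0 !scale0r.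
  have ik : i != k by rewrite eq_sym.
  by rewrite square_cross_diag ?reflG // scalerA mulrC.
rewrite (rep_yxd rep) (rep_yxd rep i m) tX vX.
rewrite [X i (_ - _)]linearB [X i (_ - _)]linearB [X i (_ + _)]linearD /=.
rewrite [X i (t *: _)]linearZ [X i (v *: _)]linearZ /= scalerN opprK.
rewrite (addrAC _ (- (v *: _))) (addrAC _ (- (v *: _))) subrK.
rewrite (addrAC _ _ (- (t *: _))) addrK -addrA -opprD; congr (_ - _).
rewrite linear_sum -big_split [RHS]exchange_big; apply: eq_bigr => b _ /=.
by rewrite addrC uX.
Qed.

End SquareBracket.

Section Centre.
Variables (F : fieldType) (n : nat) (A : algType F).
Local Notation op := {linear A -> A}.
Local Notation mp := {mpoly F[n]}.
Implicit Types (m : A) (i j k : 'I_n) (b d : bool).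
Variables (G : {group {perm sletter n}}) (t v : F) (uu : bool -> F).
Variables (X Y C E : 'I_n -> op) (Wo : {perm sletter n} -> op).
Variables (x y c e : 'I_n -> A) (w : {perm sletter n} -> A).
Hypothesis rep : hcc_rep G t uu v X Y C E Wo.
Hypothesis reflG : forall b i j, i != j -> uu b != 0 -> refl b i j \in G.
Hypothesis tauG : forall i, v != 0 -> tau_ i \in G.
Hypothesis XE : forall i m, X i m = x i * m.
Hypothesis YE : forall i m, Y i m = y i * m.
Hypothesis CE : forall i m, C i m = c i * m.
Hypothesis EE : forall i m, E i m = e i * m.
Hypothesis WE : forall s m, Wo s m = w s * m.

Lemma xC i j : x i * x j = x j * x i.
Proof. by have := rep_xx rep i j 1; rewrite !XE !mulr1. Qed.

Let x2 i := x i * x i.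

Let x2C i j : x2 i * x2 j = x2 j * x2 i.
Proof.
by apply: commrM; apply/commr_sym/commrM; apply: xC.
Qed.

Lemma crossingE b d i j m : crossing C E Wo b d i j m = crossing C E Wo b d i j 1 * m.
Proof.
have opE a (f g : op) f0 g0 m' : (forall m, f m = f0 * m) -> (forall m, g m = g0 * m) ->
    one_plus a f g m' = (1 + a *: (f0 * g0)) * m'.
  by move=> fE gE; rewrite /one_plus fE gE mulrDl mul1r -scalerAl mulrA.
by rewrite /crossing !(opE _ _ _ _ _ _ (CE _) (CE _)) !(opE _ _ _ _ _ _ (EE _) (EE _))
  !WE mulr1 !mulrA.
Qed.

Lemma sq_bracketE i j m :
  sq_bracket uu X C E Wo i j m = sq_bracket uu X C E Wo i j 1 * m.
Proof.
rewrite /sq_bracket mulr_suml; apply: eq_bigr => b _; rewrite -scalerAl; congr (_ *: _).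
by rewrite /square_cross !XE (crossingE _ _ _ _ (x j * m)) (crossingE _ _ _ _ m)
  (crossingE _ _ _ _ (x j * 1)) [RHS]mulrDl !mulr1 !mulrA.
Qed.

Lemma y_x2 i j : j != i -> y i * x2 j = x2 j * y i + sq_bracket uu X C E Wo i j 1.
Proof.
rewrite eq_sym => ij; have := sq_bracket_offdiag rep 1 ij.
by rewrite !XE !YE !mulr1 !mulrA.
Qed.

Lemma y_x2_diag i : y i * x2 i = x2 i * y i
  - \sum_(j < n | j != i) sq_bracket uu X C E Wo i j 1.
Proof.
have := sq_bracket_diag rep reflG tauG i 1.
by rewrite !XE !YE !mulr1 !mulrA.
Qed.

Lemma sq_bracket_x2 i j k : j != i ->
  sq_bracket uu X C E Wo i j 1 * x2 k = x2 (tperm i j k) * sq_bracket uu X C E Wo i j 1.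
Proof.
move=> ji; have ij : i != j by rewrite eq_sym.
rewrite -sq_bracketE /sq_bracket mulr_sumr; apply: eq_bigr => b _.
have [->|ub] := eqVneq (uu b) 0; first by rewrite mulr0 !scale0r mulr0.
rewrite -scalerAr; congr (_ *: _).
by have := square_crossX rep k 1 ij (reflG ij ub); rewrite !XE !mulr1 !mulrA => ->.
Qed.

Definition squares : n.-tuple mp := [tuple 'X_i ^+ 2 | i < n].

Lemma eval_squares q : eval_at x (q \mPo squares) = eval_at x2 q.
Proof.
apply/esym/eval_at_comp => [|i]; first exact: xC.
by rewrite tnth_mktuple expr2 eval_atM ?eval_atX //; apply: xC.
Qed.

Definition symmetric_poly (q : mp) : Prop := forall i j, weyl_act (refl false i j) q = q.

Lemma centre_y i q : symmetric_poly q -> y i * eval_at x2 q = eval_at x2 q * y i.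
Proof.
move=> sq; apply: (bracket_symmetric (D := fun j => sq_bracket uu X C E Wo i j 1)).
- exact: x2C.
- by move=> j; apply: y_x2.
- exact: y_x2_diag.
- by move=> j k; apply: sq_bracket_x2.
- by move=> j; apply: sq.
Qed.

Lemma c_x i j : c i * x j = (-1) ^+ (i == j) *: (x j * c i).
Proof. by have := rep_cx rep i j 1; rewrite !(CE, XE) !mulr1. Qed.

Lemma e_x i j : e i * x j = x j * e i.
Proof. by have := rep_ex rep i j 1; rewrite !(EE, XE) !mulr1. Qed.

Lemma w_x s i : s \in G -> w s * x i = (-1) ^+ ssgn s i *: (x (spos s i) * w s).
Proof. by move=> sG'; have := rep_wx rep i 1 sG'; rewrite !XE !WE !mulr1. Qed.

Lemma centre_x i q : x i * eval_at x2 q = eval_at x2 q * x i.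
Proof.
by apply: eval_at_comm => [|j]; [exact: x2C|apply: commrM; apply: xC].
Qed.

Lemma centre_e i q : e i * eval_at x2 q = eval_at x2 q * e i.
Proof.
by apply: eval_at_comm => [|j]; [exact: x2C|apply: commrM; apply: e_x].
Qed.

Lemma centre_c i q : c i * eval_at x2 q = eval_at x2 q * c i.
Proof.
apply: eval_at_comm => [|j]; first exact: x2C.
rewrite -[x2 j]/(x j * x j) mulrA c_x -scalerAl -(mulrA (x j) (c i)) c_x -scalerAr scalerA sign2 scale1r.
by rewrite mulrA.
Qed.

Lemma w_eval s p : s \in G -> w s * eval_at x p = eval_at x (weyl_act s p) * w s.
Proof.
move=> sG'; pose x' i := (-1) ^+ ssgn s i *: x (spos s i).
have x'C i j : x' i * x' j = x' j * x' i.
  by rewrite /x' -!scalerAl -!scalerAr !scalerA mulrC xC.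
rewrite (eval_at_twist (b := x')) ?/weyl_act //; first last.
- by move=> i; rewrite w_x // -scalerAl.
- exact: xC.
congr (_ * _); apply: eval_at_comp => [|i]; first exact: xC.
by rewrite tnth_mktuple (sactE _ (fun k => 'X_k : mp)) eval_atZ eval_atX.
Qed.

End Centre.

Section Squares.
Variables (F : fieldType) (n : nat).
Local Notation mp := {mpoly F[n]}.

(** Needed to pass from the invariance of q(x^2) to that of q. *)
Lemma squares_inj (q q' : mp) : q \mPo squares F n = q' \mPo squares F n -> q = q'.
Proof.
have coef (p : mp) k : (p \mPo squares F n)@_(k + k) = p@_k.
  elim/mpolyind: p => [|a m p _ _ IH]; first by rewrite comp_mpoly0 !mcoeff0.
  rewrite comp_mpolyD comp_mpolyZ !mcoeffD !mcoeffZ IH; congr (_ * _ + _).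
  have -> : 'X_[m] \mPo squares F n = 'X_[m + m] :> mp.
    rewrite comp_mpolyX [RHS]mpolyXE_id; apply: eq_bigr => i _.
    by rewrite tnth_mktuple -exprM mnmDE addnn mul2n.
  rewrite !mcoeffX; congr ((nat_of_bool _)%:R); apply/eqP/eqP => [mk|->//].
  apply/mnmP => i; have := congr1 (fun f : 'X_{1..n} => f i) mk.
  by rewrite !mnmDE !addnn => /double_inj.
by move=> qq; apply/mpolyP => k; rewrite -(coef q) -(coef q') qq.
Qed.

Lemma weyl_squares s (q : mp) :
  weyl_act s (q \mPo squares F n) = (q \mPo [tuple 'X_(spos s i) | i < n]) \mPo squares F n.
Proof.
elim/mpoly_XU_ind: q => [a|p q IHp IHq|i q IH].
- by rewrite !comp_mpolyC weyl_actC.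
- by rewrite !comp_mpolyD raddfD /= IHp IHq.
- rewrite !rmorphM /= IH !comp_mpolyXU -!tnth_nth !tnth_mktuple; congr (_ * _).
  rewrite rmorphXn /= weyl_actX comp_mpolyXU -tnth_nth tnth_mktuple.
  by rewrite exprZn sqrr_sign scale1r.
Qed.

Lemma sq_invariant_symmetric T (q : mp) :
  (forall s, s \in weyl T n -> weyl_act s (q \mPo squares F n) = q \mPo squares F n) ->
  forall i j, weyl_act (refl false i j) q = q.
Proof.
move=> inv i j; apply: squares_inj; rewrite -[RHS](inv (refl false i j)) ?s_weyl //.
rewrite weyl_squares; congr (_ \mPo _); rewrite /weyl_act; congr (_ \mPo _).
apply: eq_from_tnth => k; rewrite !tnth_mktuple (sactE _ (fun k => 'X_k : mp)).
by rewrite ssgn_refl scale1r.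
Qed.
End Squares.

(** * Finite spans over the invariants *)

Section Span.
Variables (A : pzRingType) (Z : A -> Prop).

(** Linear combinations of the entries of b with coefficients in Z, in a form that
    avoids indices; zspan_coord restores them. *)
Inductive zspan (b : seq A) : A -> Prop :=
| zspan0 : zspan b 0
| zspan_cons z g h : Z z -> g \in b -> zspan b h -> zspan b (z * g + h).

Hypothesis Z1 : Z 1.
Hypothesis ZM : forall z z', Z z -> Z z' -> Z (z * z').
Hypothesis ZC : forall z h, Z z -> z * h = h * z.

Lemma zspan_gen b g : g \in b -> zspan b g.
Proof. by move=> gb; rewrite -[g]addr0 -[g]mul1r; apply: zspan_cons => //; apply: zspan0. Qed.

Lemma zspanD b h h' : zspan b h -> zspan b h' -> zspan b (h + h').
Proof.
move=> bh bh'; elim: bh => [|z g k Zz gb _ IH]; first by rewrite add0r.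
by rewrite -addrA; apply: zspan_cons.
Qed.

Lemma zspan_sum b (I : Type) (r : seq I) (P : pred I) (f : I -> A) :
  (forall i, P i -> zspan b (f i)) -> zspan b (\sum_(i <- r | P i) f i).
Proof. by move=> bf; apply: big_ind => //; [apply: zspan0|apply: zspanD]. Qed.

Lemma zspanZ b z h : Z z -> zspan b h -> zspan b (z * h).
Proof.
move=> Zz; elim=> [|z' g k Zz' gb _ IH]; first by rewrite mulr0; apply: zspan0.
by rewrite mulrDr mulrA; apply: zspan_cons => //; apply: ZM.
Qed.

(** This is where Z has to be central. *)
Lemma zspanM b b' h h' : zspan b h -> zspan b' h' ->
  zspan [seq g * g' | g <- b, g' <- b'] (h * h').
Proof.
move=> bh bh'; elim: bh => [|z g k Zz gb _ IH]; first by rewrite mul0r; apply: zspan0.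
rewrite mulrDl; apply: zspanD => //; rewrite -mulrA; apply: zspanZ => //.
elim: bh' => [|z' g' k' Zz' gb' _ IH']; first by rewrite mulr0; apply: zspan0.
rewrite mulrDr mulrA -(ZC g Zz') -mulrA; apply: zspan_cons => //.
exact: allpairs_f.
Qed.

Lemma zspan_coord b h : Z 0 -> (forall z z', Z z -> Z z' -> Z (z + z')) ->
  zspan b h -> exists z : 'I_(size b) -> A,
  (forall k, Z (z k)) /\ h = \sum_(k < size b) z k * b`_k.
Proof.
move=> Z0 ZD; elim=> [|z g k Zz gb _ [z' [Zz' ->]]].
  by exists (fun=> 0); split=> //; rewrite big1 // => i _; rewrite mul0r.
have gi : (index g b < size b)%N by rewrite index_mem.
exists (fun k => (if k == Ordinal gi then z else 0) + z' k); split=> [i|].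
  by apply: ZD => //; case: ifP.
under [RHS]eq_bigr => i _ do rewrite mulrDl.
rewrite big_split /=; congr (_ + _); rewrite (bigD1 (Ordinal gi)) //= eqxx nth_index //.
by rewrite big1 ?addr0 // => i /negPf ->; rewrite mul0r.
Qed.

Lemma zspan_prod (I : eqType) (f : I -> nat -> A) (r : seq I) :
  (forall i, exists b, forall k, zspan b (f i k)) ->
  exists b, forall m : I -> nat, zspan b (\prod_(i <- r) f i (m i)).
Proof.
move=> fb; elim: r => [|i r [b bP]].
  by exists [:: 1] => m; rewrite big_nil; apply: zspan_gen; rewrite inE.
have [b' b'P] := fb i; exists [seq g * g' | g <- b', g' <- b] => m.
by rewrite big_cons; apply: zspanM.
Qed.

End Span.

Lemma zspan_morph (A B : pzRingType) (Z : A -> Prop) (Z' : B -> Prop) (f : A -> B) b h :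
  f 0 = 0 -> (forall p q, f (p + q) = f p + f q) -> (forall p q, f (p * q) = f p * f q) ->
  (forall z, Z z -> Z' (f z)) -> zspan Z b h -> zspan Z' [seq f g | g <- b] (f h).
Proof.
move=> f0 fD fM ZZ; elim=> [|z g k Zz gb _ IH]; first by rewrite f0; apply: zspan0.
by rewrite fD fM; apply: zspan_cons; [apply: ZZ|apply: map_f|].
Qed.

Lemma coef_prod_XsubC_map (R S : comNzRingType) (f : {rmorphism R -> S}) (I : finType)
    (g : I -> R) (h : I -> S) k : (forall i, h i = f (g i)) ->
  (\prod_i ('X - (h i)%:P))`_k = f (\prod_i ('X - (g i)%:P))`_k.
Proof.
move=> hfg; rewrite -coef_map map_prod_XsubC.
by under eq_bigr => i _ do rewrite hfg.
Qed.

Lemma coef_prod_XsubC_fixed (R : comNzRingType) (f : {rmorphism R -> R}) (I : finType)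
    (g : I -> R) (s : I -> I) k : injective s -> (forall i, f (g i) = g (s i)) ->
  f (\prod_i ('X - (g i)%:P))`_k = (\prod_i ('X - (g i)%:P))`_k.
Proof.
move=> s_inj fg; rewrite [in RHS](reindex_inj s_inj).
by apply/esym/coef_prod_XsubC_map => i; rewrite fg.
Qed.

Lemma power_root_XsubC (R : comNzRingType) n (g : 'I_n -> R) i :
  g i ^+ n = - \sum_(r < n) (\prod_j ('X - (g j)%:P))`_r * g i ^+ r.
Proof.
set P := \prod_j _; have sP : size P = n.+1.
  by rewrite /P size_prod_XsubC -[index_enum _]enumT size_enum_ord.
have P0 : P.[g i] = 0.
  by rewrite /P horner_prod (bigD1 i) //= hornerXsubC subrr mul0r.
have Pn : P`_n = 1.
  have := monic_prod_XsubC (index_enum 'I_n) xpredT g.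
  by rewrite monicE lead_coefE -/P sP => /eqP.
move: P0; rewrite horner_coef sP big_ord_recr /= Pn mul1r => /eqP.
by rewrite addrC addr_eq0 => /eqP.
Qed.

Section PolynomialFiniteness.
Variables (F : fieldType) (n : nat) (T : weyl_type).
Local Notation mp := {mpoly F[n]}.
Local Notation Z := (@sq_invariant F n T).
Local Notation sq := (squares F n).

Lemma sq_invariantC c : Z c%:MP.
Proof. by split=> [|s _]; [exists c%:MP; rewrite comp_mpolyC|rewrite weyl_actC]. Qed.

Lemma sq_invariantM p q : Z p -> Z q -> Z (p * q).
Proof.
move=> [[p' pE] pW] [[q' qE] qW]; split; first by exists (p' * q'); rewrite rmorphM pE qE.
by move=> s sW; rewrite rmorphM /= pW // qW.
Qed.

Definition sq_char_poly : {poly mp} := \prod_(j < n) ('X - ('X_j ^+ 2)%:P).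

Lemma sq_char_poly_coef k : Z sq_char_poly`_k.
Proof.
split.
  exists (\prod_(j < n) ('X - ('X_j : mp)%:P))`_k.
  apply: (coef_prod_XsubC_map (f := comp_mpoly sq)) => j.
  by rewrite /= comp_mpolyXU -tnth_nth tnth_mktuple.
move=> s sW; have sB : s \in WB n by apply: (subsetP (weyl_WB T n)).
apply: (@coef_prod_XsubC_fixed mp (@weyl_act F n s) _ (fun j => 'X_j ^+ 2) (spos s)) => [|j].
  exact: spos_inj.
by rewrite [LHS]rmorphXn /= weyl_actX exprZn sqrr_sign scale1r.
Qed.

(** The monic polynomial with roots x_j^2 has degree n and invariant coefficients;
    its value at x_i^2 expresses x_i^(2 n) by lower powers of x_i. *)
Lemma power_zspan i : exists b, forall k, zspan Z b ('X_i ^+ k : mp).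
Proof.
exists [seq 'X_i ^+ r | r <- iota 0 (2 * n)] => k.
have Z1 : Z 1 by rewrite -mpolyC1; apply: sq_invariantC.
elim/ltn_ind: k => k IH; have [kn|nk] := ltnP k (2 * n).
  apply: zspan_gen => //; apply/mapP; exists k => //.
  by rewrite mem_iota.
have e : 'X_i ^+ (2 * n) = - \sum_(r < n) sq_char_poly`_r * 'X_i ^+ (2 * r) :> mp.
  rewrite exprM (power_root_XsubC (fun j => 'X_j ^+ 2 : mp)); congr (- _).
  by apply: eq_bigr => r _; rewrite -exprM.
rewrite -(subnKC nk) exprD e mulNr -mulN1r mulr_suml mulr_sumr.
apply: zspan_sum => r _; rewrite -mulrA -exprD mulrA; apply: zspanZ.
- exact: sq_invariantM.
- apply: sq_invariantM (sq_char_poly_coef r).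
  by rewrite -mpolyC1 -mpolyCN; apply: sq_invariantC.
- apply: IH; have rn := ltn_ord r; rewrite -{2}(subnKC nk) ltn_add2r.
  by rewrite ltn_mul2l.
Qed.

Lemma mpoly_zspan : exists b, forall p : mp, zspan Z b p.
Proof.
have Z1 : Z 1 by rewrite -mpolyC1; apply: sq_invariantC.
have [//|//|b bP] := @zspan_prod mp Z Z1 _ _ _ (fun i k => 'X_i ^+ k) (index_enum 'I_n) power_zspan.
- exact: sq_invariantM.
- by move=> z h _; rewrite mulrC.
exists b => p; rewrite [p]mpolyE; apply: zspan_sum => m _.
rewrite -mul_mpolyC; apply: zspanZ; [exact: sq_invariantM|exact: sq_invariantC|].
by rewrite mpolyXE_id; apply: bP.
Qed.

End PolynomialFiniteness.

(** * Ordered products span *)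

Section SignedMonomials.
Variables (F : fieldType) (n : nat) (A : algType F).
Implicit Types (i j : 'I_n) (f : {ffun 'I_n -> bool}).

Lemma eval_at_pass (a : 'I_n -> A) w0 (b : 'I_n -> bool) (pi : 'I_n -> 'I_n) p :
  (forall i j, a i * a j = a j * a i) ->
  (forall i, w0 * a i = (-1) ^+ b i *: (a (pi i) * w0)) ->
  exists p', w0 * eval_at a p = eval_at a p' * w0.
Proof.
move=> aC wa; exists (p \mPo [tuple (-1) ^+ b i *: 'X_(pi i) | i < n]).
rewrite (eval_at_twist (b := fun i => (-1) ^+ b i *: a (pi i))) //.
- congr (_ * _); apply: eval_at_comp => // i.
  by rewrite tnth_mktuple eval_atZ eval_atX.
- by move=> i j; rewrite -!scalerAl -!scalerAr !scalerA mulrC aC.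
- by move=> i; rewrite wa scalerAl.
Qed.

Variable u : 'I_n -> A.
Hypothesis u2 : forall i, u i * u i = 1.
Hypothesis uu : forall i j, i != j -> u i * u j = - (u j * u i).

Definition mono f : A := \prod_(i < n) u i ^+ f i.

Lemma mono_mull j f : exists b f', u j * mono f = (-1) ^+ (b : bool) *: mono f'.
Proof.
pose f' := [ffun i => f i (+) (i == j)].
suff [b bE] : exists b : bool, u j * mono f = (-1) ^+ b *: mono f' by exists b, f'.
rewrite /mono; have := mem_index_enum j; have := index_enum_uniq 'I_n.
elim: (index_enum _) => [|i r IH] //= /andP[ir ur].
rewrite !big_cons inE; case: (eqVneq j i) => [ji|ji] /= jr.
  rewrite -ji in ir *; exists false; rewrite expr0 scale1r mulrA; congr (_ * _).
    by rewrite ffunE eqxx addbT; case: (f j); rewrite ?expr1 ?expr0 ?u2 ?mulr1.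
  apply: eq_big_seq => k kr; rewrite ffunE; case: eqP => [kj|]; last by rewrite addbF.
  by rewrite -kj kr in ir.
have [b IHb] := IH ur jr; exists (b (+) f i).
rewrite mulrA; have -> : u j * u i ^+ f i = (-1) ^+ f i *: (u i ^+ f i * u j).
  by case: (f i); rewrite ?expr0 ?expr1 ?scale1r ?mulr1 ?mul1r // scaleN1r uu.
rewrite -scalerAl -mulrA IHb -scalerAr scalerA -signr_addb addbC ffunE.
by rewrite eq_sym (negPf ji) addbF.
Qed.

Lemma mono_pass w0 (b : 'I_n -> bool) (pi : 'I_n -> 'I_n) f :
  (forall i, w0 * u i = (-1) ^+ b i *: (u (pi i) * w0)) ->
  exists b' f', w0 * mono f = (-1) ^+ (b' : bool) *: (mono f' * w0).
Proof.
move=> wu; rewrite {1}/mono; elim: (index_enum _) => [|i r [b' [f' IH]]].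
  exists false, [ffun=> false]; rewrite big_nil scale1r mulr1 /mono big1 ?mul1r // => i _.
  by rewrite ffunE.
rewrite big_cons mulrA; case fi: (f i); last by exists b', f'; rewrite mulr1.
have [b2 [f2 E2]] := mono_mull (pi i) f'.
exists (b i (+) b' (+) b2), f2.
by rewrite expr1 wu -scalerAl -mulrA IH -scalerAr mulrA E2 -scalerAl !scalerA -!signr_addb.
Qed.

End SignedMonomials.

Section NormalOrder.
Variables (F : fieldType) (n : nat) (A : algType F).
Local Notation op := {linear A -> A}.
Local Notation mp := {mpoly F[n]}.
Implicit Types (m h : A) (i j k : 'I_n) (b d : bool) (p q : mp) (f g : {ffun 'I_n -> bool}).
Variables (G : {group {perm sletter n}}) (t v : F) (uu : bool -> F).
Variables (X Y C E : 'I_n -> op) (Wo : {perm sletter n} -> op).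
Variables (x y c e : 'I_n -> A) (w : {perm sletter n} -> A).
Hypothesis rep : hcc_rep G t uu v X Y C E Wo.
Hypothesis reflG : forall b i j, i != j -> uu b != 0 -> refl b i j \in G.
Hypothesis tauG : forall i, v != 0 -> tau_ i \in G.
Hypothesis XE : forall i m, X i m = x i * m.
Hypothesis YE : forall i m, Y i m = y i * m.
Hypothesis CE : forall i m, C i m = c i * m.
Hypothesis EE : forall i m, E i m = e i * m.
Hypothesis WE : forall s m, Wo s m = w s * m.
Let cw := rep_cw rep.

Let xx i j : x i * x j = x j * x i.
Proof. by have := rep_xx rep i j 1; rewrite !XE !mulr1. Qed.
Let yy i j : y i * y j = y j * y i.
Proof. by have := rep_yy rep i j 1; rewrite !YE !mulr1. Qed.
Let c2 i : c i * c i = 1.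
Proof. by have := rep_c2 cw i 1; rewrite !CE mulr1. Qed.
Let e2 i : e i * e i = 1.
Proof. by have := rep_e2 cw i 1; rewrite !EE mulr1. Qed.
Let cc i j : i != j -> c i * c j = - (c j * c i).
Proof. by move=> ij; have := rep_cc cw 1 ij; rewrite !CE !mulr1. Qed.
Let ee i j : i != j -> e i * e j = - (e j * e i).
Proof. by move=> ij; have := rep_ee cw 1 ij; rewrite !EE !mulr1. Qed.
Let ec i j : e i * c j = (-1) ^+ true *: (c j * e i).
Proof.
have := rep_ce cw j i 1; rewrite !(CE, EE) !mulr1 => ->.
by rewrite expr1 scaleN1r opprK.
Qed.
Let cx i j : c i * x j = (-1) ^+ (i == j) *: (x j * c i).
Proof. by have := rep_cx rep i j 1; rewrite !(CE, XE) !mulr1. Qed.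
Let ex i j : e i * x j = x j * e i.
Proof. by have := rep_ex rep i j 1; rewrite !(EE, XE) !mulr1. Qed.
Let cy i j : c i * y j = y j * c i.
Proof. by have := rep_cy rep i j 1; rewrite !(CE, YE) !mulr1. Qed.
Let ey i j : e i * y j = (-1) ^+ (i == j) *: (y j * e i).
Proof. by have := rep_ey rep i j 1; rewrite !(EE, YE) !mulr1. Qed.
Let wx s i : s \in G -> w s * x i = (-1) ^+ ssgn s i *: (x (spos s i) * w s).
Proof. by move=> sG; have := rep_wx rep i 1 sG; rewrite !(WE, XE) !mulr1. Qed.
Let wy s i : s \in G -> w s * y i = (-1) ^+ ssgn s i *: (y (spos s i) * w s).
Proof. by move=> sG; have := rep_wy rep i 1 sG; rewrite !(WE, YE) !mulr1. Qed.
Let wc s i : s \in G -> w s * c i = (-1) ^+ ssgn s i *: (c (spos s i) * w s).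
Proof. by move=> sG; have := rep_wc cw i 1 sG; rewrite !(WE, CE) !mulr1. Qed.
Let we s i : s \in G -> w s * e i = (-1) ^+ ssgn s i *: (e (spos s i) * w s).
Proof. by move=> sG; have := rep_we cw i 1 sG; rewrite !(WE, EE) !mulr1. Qed.
Let wM s s' : s \in G -> s' \in G -> w s * w s' = w (s' * s)%g.
Proof. by move=> sG sG'; have := rep_wM cw 1 sG sG'; rewrite !WE !mulr1. Qed.
Let w1 : w 1%g = 1.
Proof. by have := rep_w1 cw 1; rewrite WE mulr1. Qed.

(** These products are associated to the right, as they are built by multiplying
    from the left. *)
Definition ordered p q f g s : A :=
  eval_at x p * (eval_at y q * (mono c f * (mono e g * w s))).

Inductive pbw_span : A -> Prop :=
| pbw_span0 : pbw_span 0
| pbw_span_cons p q f g s h : s \in G -> pbw_span h -> pbw_span (ordered p q f g s + h).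

Lemma pbw_span_ordered p q f g s : s \in G -> pbw_span (ordered p q f g s).
Proof. by move=> sG; rewrite -[ordered _ _ _ _ _]addr0; apply: pbw_span_cons => //; apply: pbw_span0. Qed.

Lemma pbw_spanD h h' : pbw_span h -> pbw_span h' -> pbw_span (h + h').
Proof.
move=> Nh Nh'; elim: Nh => [|p q f g s k sG _ IH]; first by rewrite add0r.
by rewrite -addrA; apply: pbw_span_cons.
Qed.

Lemma pbw_span_sum (I : Type) (r : seq I) (P : pred I) (F' : I -> A) :
  (forall l, P l -> pbw_span (F' l)) -> pbw_span (\sum_(l <- r | P l) F' l).
Proof. by move=> NF; apply: big_ind => //; [apply: pbw_span0|apply: pbw_spanD]. Qed.

Lemma pbw_spanZ a h : pbw_span h -> pbw_span (a *: h).
Proof.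
elim=> [|p q f g s k sG _ IH]; first by rewrite scaler0; apply: pbw_span0.
by rewrite scalerDr /ordered scalerAl -eval_atZ; apply: pbw_span_cons.
Qed.

Lemma pbw_spanN h : pbw_span h -> pbw_span (- h).
Proof. by rewrite -scaleN1r; apply: pbw_spanZ. Qed.

Lemma pbw_span_mull a : (forall p q f g s, s \in G -> pbw_span (a * ordered p q f g s)) ->
  forall h, pbw_span h -> pbw_span (a * h).
Proof.
move=> Na h; elim=> [|p q f g s k sG _ IH]; first by rewrite mulr0; apply: pbw_span0.
by rewrite mulrDr; apply: pbw_spanD => //; apply: Na.
Qed.

Lemma pbw_span_x i h : pbw_span h -> pbw_span (x i * h).
Proof.
apply: pbw_span_mull => p q f g s sG; rewrite /ordered mulrA -(eval_atX x) -eval_atM //.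
exact: pbw_span_ordered.
Qed.

Lemma pbw_span_c i h : pbw_span h -> pbw_span (c i * h).
Proof.
apply: pbw_span_mull => p q f g s sG; rewrite /ordered mulrA.
have [p' ->] := eval_at_pass (pi := id) p xx (cx i).
rewrite -mulrA [c i * _]mulrA (eval_at_comm q yy (cy i)) -mulrA [c i * _]mulrA.
have [b [f' ->]] := mono_mull c2 cc i f.
by rewrite -scalerAl -!scalerAr; apply/pbw_spanZ/pbw_span_ordered.
Qed.

Lemma pbw_span_e i h : pbw_span h -> pbw_span (e i * h).
Proof.
apply: pbw_span_mull => p q f g s sG; rewrite /ordered mulrA (eval_at_comm p xx (ex i)).
have [q' qE] := eval_at_pass (pi := id) q yy (ey i).
rewrite -mulrA [e i * _]mulrA qE -mulrA [e i * _]mulrA.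
have [b [f' ->]] := mono_pass (pi := id) c2 cc f (ec i).
rewrite -scalerAl -mulrA [e i * _]mulrA; have [b' [g' ->]] := mono_mull e2 ee i g.
by rewrite -scalerAl -!scalerAr; do 2!apply/pbw_spanZ; apply/pbw_span_ordered.
Qed.

Lemma pbw_span_w s h : s \in G -> pbw_span h -> pbw_span (w s * h).
Proof.
move=> sG; apply: pbw_span_mull => p q f g s' sG'; rewrite /ordered mulrA.
have [p' ->] := eval_at_pass p xx (fun i => wx i sG).
rewrite -mulrA [w s * _]mulrA; have [q' ->] := eval_at_pass q yy (fun i => wy i sG).
rewrite -mulrA [w s * _]mulrA.
have [b [f' ->]] := mono_pass c2 cc f (fun i => wc i sG).
rewrite -scalerAl -mulrA [w s * _]mulrA.
have [b' [g' ->]] := mono_pass e2 ee g (fun i => we i sG).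
rewrite -scalerAl -!scalerAr -mulrA wM //.
by do 2!apply/pbw_spanZ; apply/pbw_span_ordered; rewrite groupM.
Qed.

Lemma pbw_span_crossing b d i j m : refl b i j \in G -> pbw_span m ->
  pbw_span (crossing C E Wo b d i j m).
Proof.
move=> rG Nm; rewrite /crossing.
have N1 a (f g : op) m' : (forall h, pbw_span h -> pbw_span (f h)) ->
    (forall h, pbw_span h -> pbw_span (g h)) -> pbw_span m' -> pbw_span (one_plus a f g m').
  by move=> Nf Ng Nm'; rewrite /one_plus; apply: pbw_spanD => //; apply/pbw_spanZ/Nf/Ng.
have NC k h : pbw_span h -> pbw_span (C k h) by rewrite CE; apply: pbw_span_c.
have NE k h : pbw_span h -> pbw_span (E k h) by rewrite EE; apply: pbw_span_e.
apply: (N1); [exact: NC|exact: NC|apply: (N1); [exact: NE|exact: NE|]].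
by rewrite WE; apply: pbw_span_w.
Qed.

(** Move y_j past the variables of p one at a time: each commutator is a sum of
    products of elements c, e and w, which preserve the span. *)
Lemma pbw_span_y j h : pbw_span h -> pbw_span (y j * h).
Proof.
apply: pbw_span_mull => p q f g s sG.
elim/mpoly_XU_ind: p => [a|p p' IH IH'|i p IH].
- rewrite /ordered eval_atC -scalerAl mul1r -scalerAr; apply: pbw_spanZ.
  rewrite (mulrA (y j)) -(eval_atX y) -eval_atM // -[_ * _]mul1r -(eval_at1 x).
  exact: pbw_span_ordered.
- by rewrite /ordered eval_atD mulrDl mulrDr; apply: pbw_spanD.
- set m := ordered p q f g s in IH.
  have -> : y j * ordered ('X_i * p) q f g s = Y j (X i m).
    by rewrite YE XE /m /ordered eval_atM // eval_atX -mulrA.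
  have Nm : pbw_span m by apply: pbw_span_ordered.
  have [<-|ji] := eqVneq j i; last first.
    rewrite (rep_yx rep) // XE YE; apply: pbw_spanD; first exact: pbw_span_x.
    apply: pbw_span_sum => b _; have [->|ub] := eqVneq (uu b) 0.
      by rewrite mulr0 scale0r; apply: pbw_span0.
    by apply: pbw_spanZ; apply: pbw_span_crossing => //; apply: reflG.
  rewrite (rep_yxd rep) XE YE CE EE WE; apply: pbw_spanD; last first.
    have [->|v0] := eqVneq v 0; first by rewrite scale0r oppr0; apply: pbw_span0.
    by apply/pbw_spanN/pbw_spanZ/pbw_span_w => //; apply: tauG.
  apply: pbw_spanD; first apply: pbw_spanD; first exact: pbw_span_x.
    by apply/pbw_spanZ/pbw_span_c/pbw_span_e.
  apply/pbw_spanN/pbw_span_sum => b _; have [->|ub] := eqVneq (uu b) 0.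
    by rewrite scale0r; apply: pbw_span0.
  apply/pbw_spanZ/pbw_span_sum => k kj; apply: pbw_span_crossing => //.
  by apply: reflG; rewrite // eq_sym.
Qed.

Lemma pbw_span1 : pbw_span 1.
Proof.
have mono0 (u : 'I_n -> A) : mono u [ffun=> false] = 1.
  by rewrite /mono big1 // => i _; rewrite ffunE.
have := pbw_span_ordered 1 1 [ffun=> false] [ffun=> false] (group1 G).
by rewrite /ordered !eval_at1 !mono0 w1 !mul1r.
Qed.

Section Finite.
Variables (T : weyl_type) (Z : A -> Prop).
Hypothesis Z1 : Z 1.
Hypothesis ZM : forall z z', Z z -> Z z' -> Z (z * z').
Hypothesis ZC : forall z h, Z z -> z * h = h * z.
Hypothesis Zx : forall p, sq_invariant T p -> Z (eval_at x p).
Hypothesis Zy : forall p, sq_invariant T p -> Z (eval_at y p).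

Lemma pbw_span_zspan : exists B, forall h, pbw_span h -> zspan Z B h.
Proof.
have [B BP] := mpoly_zspan F n T.
have fin (a : 'I_n -> A) p : (forall i j, a i * a j = a j * a i) ->
    (forall p, sq_invariant T p -> Z (eval_at a p)) ->
    zspan Z [seq eval_at a r | r <- B] (eval_at a p).
  move=> aC Za; apply: (zspan_morph _ _ _ Za (BP p)).
  - exact: eval_at0.
  - exact: eval_atD.
  - by move=> p' q'; apply: eval_atM.
have finM (u : 'I_n -> A) f : zspan Z [seq mono u f' | f' : {ffun 'I_n -> bool}] (mono u f).
  by apply: zspan_gen => //; apply: image_f.
have finW s : s \in G -> zspan Z [seq w s' | s' in G] (w s).
  by move=> sG; apply: zspan_gen => //; apply: image_f.
eexists => h; elim=> [|p q f g s k sG _ IH]; first exact: zspan0.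
apply: zspanD IH; rewrite /ordered.
have ZspanM := @zspanM A Z ZM ZC.
exact: ZspanM _ _ _ _ (fin x p xx Zx) (ZspanM _ _ _ _ (fin y q yy Zy) (ZspanM _ _ _ _ (finM c f)
  (ZspanM _ _ _ _ (finM e g) (finW s sG)))).
Qed.

End Finite.
End NormalOrder.

(** * The even center *)

Section EvalCentral.
Variables (F : fieldType) (n : nat) (A : algType F) (T : weyl_type).
Local Notation op := {linear A -> A}.
Variables (t v : F) (uu : bool -> F).
Variables (X Y C E : 'I_n -> op) (Wo : {perm sletter n} -> op).
Variables (x y c e : 'I_n -> A) (w : {perm sletter n} -> A).
Hypothesis rep : hcc_rep (weyl T n) t uu v X Y C E Wo.
Hypothesis reflG : forall b i j, i != j -> uu b != 0 -> refl b i j \in weyl T n.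
Hypothesis tauG : forall i, v != 0 -> tau_ i \in weyl T n.
Hypothesis XE : forall i m, X i m = x i * m.
Hypothesis YE : forall i m, Y i m = y i * m.
Hypothesis CE : forall i m, C i m = c i * m.
Hypothesis EE : forall i m, E i m = e i * m.
Hypothesis WE : forall s m, Wo s m = w s * m.

Lemma eval_central p : sq_invariant T p -> let z := eval_at x p in
  [/\ forall i, x i * z = z * x i, forall i, y i * z = z * y i,
      forall i, c i * z = z * c i, forall i, e i * z = z * e i &
      forall s, s \in weyl T n -> w s * z = z * w s].
Proof.
move=> [[q pE] pW] z; have zE : z = eval_at (fun i => x i * x i) q.
  by rewrite /z pE (eval_squares rep XE).
have qS : symmetric_poly q.
  by apply: (@sq_invariant_symmetric _ _ T) => s sW; have := pW s sW; rewrite pE.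
split=> [i|i|i|i|s sW]; rewrite ?zE.
- exact: (centre_x rep XE).
- exact: (centre_y rep reflG tauG XE YE CE EE WE).
- exact: (centre_c rep XE CE).
- exact: (centre_e rep XE EE).
- by rewrite -zE /z (w_eval rep XE WE) // pW.
Qed.

End EvalCentral.

Section Main.
Variables (F : numFieldType) (T : weyl_type) (n : nat) (t u v : F).
Local Notation H := (Hcc T n t u v).
Local Notation W := (weyl T n).
Local Notation Hx := (@Hx F T n t u v).
Local Notation Hy := (@Hy F T n t u v).
Local Notation Z := (@even_center F T n t u v).
Local Notation uu := (type_u T u).

Let F2 : 2%:R != 0 :> F. Proof. by rewrite Num.Theory.pnatr_eq0. Qed.

(* Only now, with the standard module at hand, is H known to be nonzero. *)
HB.instance Definition _ :=
  GRing.PzSemiRing_isNonZero.Build H (Hcc_neq0 T n t u v F2).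
HB.instance Definition _ :=
  GRing.Lmodule_isLalgebra.Build F H (@Hcc_scalerAl F T n t u v).
HB.instance Definition _ :=
  GRing.Lalgebra_isAlgebra.Build F H (@Hcc_scalerAr F T n t u v).

Let gc i : H := Hpi t u v (fc F T i).
Let ge i : H := Hpi t u v (fe F T i).
Let gw s : H := Hpi t u v (fwW F T s).

Let rep := regular_rep T n t u v.
Let rep' := hcc_rep_swap rep.

Let HxE i m : hx T t u v i m = Hx i * m. Proof. by []. Qed.
Let HyE i m : hy T t u v i m = Hy i * m. Proof. by []. Qed.
Let HcE i m : hc T t u v i m = gc i * m. Proof. by []. Qed.
Let HeE i m : he T t u v i m = ge i * m. Proof. by []. Qed.
Let HwE s m : hw T t u v s m = gw s * m. Proof. by []. Qed.

Lemma HevalE a p : Heval a p = eval_at (a : 'I_n -> H) p. Proof. by []. Qed.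

Lemma even_eval (a : 'I_n -> H) p : (forall i, Hcc_even (a i)) -> Hcc_even (Heval a p).
Proof.
move=> ea; rewrite /Heval; apply: (big_ind (@Hcc_even F T n t u v)).
- by rewrite -(scale0r (1 : H)); apply/even_scale/even1.
- by move=> h h'; apply: even_add.
- move=> m _; apply: even_scale; apply: (big_ind (@Hcc_even F T n t u v)).
  + exact: even1.
  + by move=> h h'; apply: even_mul.
  + by move=> i _; elim: (m i) => [|k IH]; rewrite ?expr0 ?exprS; [apply: even1|apply: even_mul].
Qed.

Lemma central_of_gen (z : H) :
  (forall i, Hx i * z = z * Hx i) -> (forall i, Hy i * z = z * Hy i) ->
  (forall i, gc i * z = z * gc i) -> (forall i, ge i * z = z * ge i) ->
  (forall s, s \in W -> gw s * z = z * gw s) -> forall h, z * h = h * z.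
Proof.
move=> zx zy zc ze zw; apply: Hcc_ind => [|f g IHf IHg|c f IH||i m IH|i m IH|i m IH|i m IH|s m sW IH].
- by rewrite mul0r mulr0.
- by rewrite mulrDl mulrDr IHf IHg.
- by rewrite -scalerAl -scalerAr IH.
- by rewrite mul1r mulr1.
- exact: commrM (esym (zx i)) IH.
- exact: commrM (esym (zy i)) IH.
- exact: commrM (esym (zc i)) IH.
- exact: commrM (esym (ze i)) IH.
- exact: commrM (esym (zw s sW)) IH.
Qed.

Lemma even_central_x p : sq_invariant T p -> Z (eval_at Hx p).
Proof.
move=> pT; split; first by rewrite -HevalE; apply: even_eval => i; apply: even_gen.
have [zx zy zc ze zw] := eval_central rep (@refl_weyl F T n u) (@tau_weylP F T n v)
  HxE HyE HcE HeE HwE pT.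
by apply: (central_of_gen zx zy zc ze zw).
Qed.

Lemma even_central_y p : sq_invariant T p -> Z (eval_at Hy p).
Proof.
move=> pT; split; first by rewrite -HevalE; apply: even_eval => i; apply: even_gen.
have reflG b i j : i != j -> - uu b != 0 -> refl b i j \in W.
  by rewrite oppr_eq0; apply: refl_weyl.
have tauG i : - type_v T v != 0 -> tau_ i \in W.
  by rewrite oppr_eq0; apply: tau_weylP.
have [zy zx ze zc zw] := eval_central rep' reflG tauG HyE HxE HeE HcE HwE pT.
by apply: (central_of_gen zx zy zc ze zw).
Qed.

Lemma sq_invariants_in_even_center_of (a : 'I_n -> H) :
  (forall i j, a i * a j = a j * a i) ->
  (forall p q, Heval a p = Heval a q -> p = q) ->
  (forall p, sq_invariant T p -> Z (eval_at a p)) -> sq_invariants_in_even_center a.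
Proof.
move=> aC inj cent; split.
- by rewrite HevalE eval_at1.
- by move=> k p q _ _; rewrite !HevalE eval_atD eval_atZ.
- by move=> p q _ _; rewrite !HevalE eval_atM.
- by move=> p q _ _; apply: inj.
- by move=> p pT; rewrite HevalE; apply: cent.
Qed.

Lemma Hcc_module_finite : module_finite_over Z.
Proof.
have Z1 : Z 1 by split; [apply: even1|move=> g; rewrite mul1r mulr1].
have Z0 : Z 0.
  split; last by move=> g; rewrite mul0r mulr0.
  by rewrite -(scale0r (1 : H)); apply/even_scale/even1.
have ZD z z' : Z z -> Z z' -> Z (z + z').
  move=> [ez cz] [ez' cz']; split; first exact: even_add.
  by move=> g; rewrite mulrDl mulrDr cz cz'.
have ZM z z' : Z z -> Z z' -> Z (z * z').
  move=> [ez cz] [ez' cz']; split; first exact: even_mul.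
  by move=> g; rewrite -mulrA cz' mulrA cz mulrA.
have ZC z h : Z z -> z * h = h * z by case.
have [B BP] := pbw_span_zspan gc ge gw rep HxE HyE Z1 ZM ZC even_central_x even_central_y.
exists B => h; apply: (zspan_coord Z0 ZD (BP h _)).
have reflG := @refl_weyl F T n u; have tauG := @tau_weylP F T n v.
elim/Hcc_ind: h => [|f g IHf IHg|c f IH||i m IH|i m IH|i m IH|i m IH|s m sW IH].
- exact: pbw_span0.
- exact: pbw_spanD.
- exact: pbw_spanZ.
- have N1 := pbw_span1 Hx Hy gc ge rep HwE. exact: N1.
- exact: (pbw_span_x rep HxE).
- exact: (pbw_span_y rep reflG tauG HxE HyE HcE HeE HwE).
- exact: (pbw_span_c rep HxE HyE HcE).
- exact: (pbw_span_e rep HxE HyE HcE HeE).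
- exact: (pbw_span_w rep HxE HyE HcE HeE HwE).
Qed.

Lemma Hcc_even_center : [/\ sq_invariants_in_even_center Hx,
  sq_invariants_in_even_center Hy & module_finite_over Z].
Proof.
split; last exact: Hcc_module_finite.
- apply: sq_invariants_in_even_center_of even_central_x => [i j|p q].
    exact: (xC rep HxE).
  exact: Heval_x_inj.
- apply: sq_invariants_in_even_center_of even_central_y => [i j|p q].
    exact: (xC rep' HyE).
  exact: Heval_y_inj.
Qed.

End Main.

Theorem proposition3p17 (R : realType) (T : weyl_type) (n : nat)
    (t u v : R[i]) :
  [/\ sq_invariants_in_even_center (@Hx _ T n t u v),
      sq_invariants_in_even_center (@Hy _ T n t u v) &
      module_finite_over (@even_center _ T n t u v)].
Proof. exact: Hcc_even_center. Qed.
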